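(* There exist universal constants $C,\widetilde{C},\gamma>0$ such that the following holds. Let $(\Omega,\mu)$ be a probability space and let $\mathcal{B}=(b_j)_{j\in I}$ be a bounded orthonormal system with constant $K$ on it. Let $\mathcal{F}$ be a quasi-normed space of functions on $\Omega$ which compactly embeds into $L^\infty(\Omega)$. Let $\kappa,n\in\mathbb{N}$ and let $J,J^\ast\subset I$ be finite sets, $J^\ast$ nonempty, such that there exists a $(\kappa,n,J,J^\ast,\tau)$ quasi-projection $P:L^\infty(\Omega)\to L^\infty(\Omega)$ with $\tau:=\|P\|_{L^\infty(\Omega)\to L^\infty(\Omega)}$. Put $$\eta:=\tau\cdot\sigma_n(\mathcal{F};\mathcal{B})_{L^\infty(\Omega)}+(1+\tau)\cdot E_J(\mathcal{F};\mathcal{B})_{L^\infty(\Omega)},\qquad N:=|J^\ast|,$$ and let $m$ be an integer with $$m\ge\left\lceil C\cdot K^2\cdot\kappa\cdot\log(\kappa+1)^3\cdot n\cdot\log(n+1)^3\cdot\log(N+1)\right\rceil .$$ If $t_1,\ldots,t_m$ are drawn independently and identically distributed from $\mu$, then with probability at least $1-N^{-\gamma\log(n+1)^3}$ it holds that $$\sup_{\|f\|_{\mathcal{F}}\le 1}\big\|f-R_\eta(f(t_1),\ldots,f(t_m))\big\|_{L^2(\mu)}\le\widetilde{C}\,\eta .$$ In addition, the approximant $R_\eta(f(t_1),\ldots,f(t_m))$ is contained in $V_{J^\ast}$.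
   Context: $L^\infty(\Omega)$ denotes the space of all bounded measurable functions $f:\Omega\to\mathbb{C}$ (no identification of functions agreeing $\mu$-a.e.) with norm $\|f\|_{L^\infty(\Omega)}=\sup_{x\in\Omega}|f(x)|$. A bounded orthonormal system with constant $K$ is a family $\mathcal{B}=(b_j)_{j\in I}\subset L^\infty(\Omega)$ that is orthonormal in $L^2(\mu)$ and satisfies $\|b_j\|_{L^\infty(\Omega)}\le K$ for all $j\in I$. $\log$ is the natural logarithm. For $n\in\mathbb{N}$, $\Sigma_n=\{\sum_{j\in J}c_jb_j: J\subset I,\ |J|\le n,\ (c_j)_{j\in J}\in\mathbb{C}^J\}$; for $J\subset I$, $V_J=\mathrm{span}\{b_j:j\in J\}$. For a quasi-normed function space $\mathcal{F}$ embedded into $L^\infty(\Omega)$, $$\sigma_n(\mathcal{F};\mathcal{B})_{L^\infty(\Omega)}=\sup_{\|f\|_{\mathcal{F}}\le1}\ \inf_{g\in\Sigma_n}\|f-g\|_{L^\infty(\Omega)},\qquad E_J(\mathcal{F};\mathcal{B})_{L^\infty(\Omega)}=\sup_{\|f\|_{\mathcal{F}}\le1}\ \inf_{g\in V_J}\|f-g\|_{L^\infty(\Omega)}.$$ A $(\kappa,n,J,J^\ast,\tau)$ quasi-projection ($\kappa,n\in\mathbb{N}$, $J,J^\ast\subset I$, $\tau>0$) is a linear operator $P:L^\infty(\Omega)\to L^\infty(\Omega)$ with: (i) $P(\Sigma_n)\subset\Sigma_{\kappa n}$; (ii) $Pf=f$ for all $f\in V_J$; (iii) $Pf\in V_{J^\ast}$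 for all $f\in L^\infty(\Omega)$; (iv) $P$ is bounded with $\|P\|_{L^\infty(\Omega)\to L^\infty(\Omega)}\le\tau$. Reconstruction map (basis pursuit denoising): given $\eta\ge0$, the finite set $J^\ast$ and points $t_1,\ldots,t_m\in\Omega$, put $A=(b_j(t_\ell))_{\ell\in\{1,\ldots,m\},\,j\in J^\ast}\in\mathbb{C}^{m\times J^\ast}$. For $y\in\mathbb{C}^m$ let $x^\#(y)\in\mathbb{C}^{J^\ast}$ be any (fixed) solution of the problem of minimizing $\|z\|_{\ell^1(J^\ast)}$ over $z\in\mathbb{C}^{J^\ast}$ subject to $\|Az-y\|_{\ell^2(m)}\le\eta\sqrt{m}$ if a solution exists, and $x^\#(y)=0$ otherwise. Define $R_\eta(y)=\sum_{j\in J^\ast}(x^\#(y))_j\,b_j\in V_{J^\ast}$. *)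

(* Defs.v *)
From HB Require Import structures.
From mathcomp Require Import all_boot all_order all_algebra finmap.
From mathcomp Require Import complex.
From mathcomp Require Import all_classical all_reals all_analysis.

Set Implicit Arguments.
Unset Strict Implicit.
Unset Printing Implicit Defensive.

Import Order.TTheory GRing.Theory Num.Theory.
Import numFieldNormedType.Exports.

Local Open Scope classical_set_scope.
Local Open Scope complex_scope.
Local Open Scope ring_scope.

(* The R-valued modulus; the ring_scope norm on R[i] takes values in R[i]. *)
Notation cmod := ComplexField.Normc.normc.

Section BoundedFunctions.
Context d (Omega : measurableType d) (R : realType).
Implicit Types f g : Omega -> R[i].

(* Genuine supremum, not essential supremum: functions are not identified
   almost everywhere. *)
Definition linfnorm f : \bar R := ereal_sup [set (cmod (f x))%:E | x in setT].

Definition cmeasurable f : Prop :=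
  measurable_fun setT (fun x => complex.Re (f x)) /\
  measurable_fun setT (fun x => complex.Im (f x)).

Definition Linf : set (Omega -> R[i]) :=
  [set f | cmeasurable f /\ (linfnorm f < +oo)%E].

(* Only the values of P on Linf matter. *)
Definition opnorm (P : (Omega -> R[i]) -> (Omega -> R[i])) : \bar R :=
  ereal_sup [set linfnorm (P f) | f in [set f | Linf f /\ (linfnorm f <= 1)%E]].

Definition cintegral (mu : {measure set Omega -> \bar R}) f : R[i] :=
  (\int[mu]_x complex.Re (f x))%R +i* (\int[mu]_x complex.Im (f x))%R.

Definition l2norm (mu : {measure set Omega -> \bar R}) f : \bar R :=
  Lnorm mu 2%:E (fun x => (cmod (f x))%:E).

Definition bounded_orthonormal_system (mu : {measure set Omega -> \bar R})
    (I : choiceType) (b : I -> Omega -> R[i]) (K : R) : Prop :=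
  [/\ forall j, Linf (b j),
      forall j k, cintegral mu (fun x => b j x * (b k x)^*) = (j == k)%:R &
      forall j, (linfnorm (b j) <= K%:E)%E].

Section FunctionSpaces.
Variables (F : set (Omega -> R[i])) (qn : (Omega -> R[i]) -> R).

(* Only the values of qn on F matter. *)
Definition quasi_normed_space : Prop :=
  [/\ F (fun=> 0) /\
        (forall (a : R[i]) f g, F f -> F g -> F (fun x => a * f x + g x)),
      forall f, F f -> 0 <= qn f,
      forall f, F f -> qn f = 0 -> f = (fun=> 0),
      forall (a : R[i]) f, F f -> qn (fun x => a * f x) = cmod a * qn f &
      exists c : R, forall f g, F f -> F g ->
        qn (fun x => f x + g x) <= c * (qn f + qn g)].

Definition unit_ball : set (Omega -> R[i]) := [set f | F f /\ qn f <= 1].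

(* The inclusion F -> Linf is a compact operator: the image of every bounded
   sequence has a convergent subsequence. *)
Definition compactly_embedded : Prop :=
  F `<=` Linf /\
  forall u : nat -> Omega -> R[i],
    (forall k, F (u k)) -> (exists M : R, forall k, qn (u k) <= M) ->
    exists (phi : nat -> nat) (g : Omega -> R[i]),
      [/\ {homo phi : i j / (i < j)%N}, Linf g &
          linfnorm (fun x => u (phi k) x - g x) @[k --> \oo] --> 0%E].

Definition worst_case_error (S : set (Omega -> R[i])) : \bar R :=
  ereal_sup [set ereal_inf [set linfnorm (fun x => f x - g x) | g in S]
            | f in unit_ball].

End FunctionSpaces.

Section Approximation.
Variables (I : choiceType) (b : I -> Omega -> R[i]).

Definition lincomb (J : {fset I}) (c : J -> R[i]) : Omega -> R[i] :=
  fun x => \sum_(j : J) c j * b (val j) x.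

Definition V (J : {fset I}) : set (Omega -> R[i]) :=
  [set f | exists c : J -> R[i], f = lincomb c].

Definition Sigma (n : nat) : set (Omega -> R[i]) :=
  [set f | exists (J : {fset I}) (c : J -> R[i]),
             (#|` J| <= n)%N /\ f = lincomb c].

Definition sigma_ (n : nat) (F : set (Omega -> R[i])) qn : \bar R :=
  worst_case_error F qn (Sigma n).

Definition E_ (J : {fset I}) (F : set (Omega -> R[i])) qn : \bar R :=
  worst_case_error F qn (V J).

(* The last clause makes P a bounded operator, as tau is a real number. *)
Definition quasi_projection (kappa n : nat) (J Jstar : {fset I}) (tau : R)
    (P : (Omega -> R[i]) -> (Omega -> R[i])) : Prop :=
  [/\ 0 < tau,
      (forall f, Linf f -> Linf (P f)) /\
        (forall (a : R[i]) f g, Linf f -> Linf g ->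
           P (fun x => a * f x + g x) = (fun x => a * P f x + P g x)),
      (forall f, Sigma n f -> Sigma (kappa * n) (P f)) /\
        (forall f, V J f -> P f = f),
      forall f, Linf f -> V Jstar (P f) &
      (opnorm P <= tau%:E)%E].

Section BasisPursuit.
Variables (Jstar : {fset I}) (m : nat).

Definition l1norm (z : Jstar -> R[i]) : R := \sum_(j : Jstar) cmod (z j).

Definition l2vnorm (v : 'I_m -> R[i]) : R :=
  Num.sqrt (\sum_(l < m) cmod (v l) ^+ 2).

(* [lincomb z (ts l)] is the l-th entry of A z, where A = (b_j(t_l))_(l, j). *)
Definition bpdn_feasible (eta : R) (ts : 'I_m -> Omega) (y : 'I_m -> R[i])
    (z : Jstar -> R[i]) : Prop :=
  l2vnorm (fun l => lincomb z (ts l) - y l) <= eta * Num.sqrt m%:R.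

Definition bpdn_solution (eta : R) (ts : 'I_m -> Omega) (y : 'I_m -> R[i])
    (z : Jstar -> R[i]) : Prop :=
  bpdn_feasible eta ts y z /\
  (forall z', bpdn_feasible eta ts y z' -> l1norm z <= l1norm z').

(* [xsharp ts] is the map y |-> x^#(y) for the sampling points ts. *)
Definition bpdn_selection (eta : R)
    (xsharp : ('I_m -> Omega) -> ('I_m -> R[i]) -> (Jstar -> R[i])) : Prop :=
  forall ts y,
    ((exists z, bpdn_solution eta ts y z) ->
       bpdn_solution eta ts y (xsharp ts y)) /\
    (~ (exists z, bpdn_solution eta ts y z) -> xsharp ts y = (fun=> 0)).

Definition reconstruct
    (xsharp : ('I_m -> Omega) -> ('I_m -> R[i]) -> (Jstar -> R[i]))
    (ts : 'I_m -> Omega) (y : 'I_m -> R[i]) : Omega -> R[i] :=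
  lincomb (xsharp ts y).

End BasisPursuit.

End Approximation.

Definition iid (mu : probability Omega R) d' (W : measurableType d')
    (Pr : probability W R) (m : nat) (t : 'I_m -> {RV Pr >-> Omega}) : Prop :=
  (forall l (A : set Omega), measurable A -> distribution Pr (t l) A = mu A) /\
  (forall (S : {set 'I_m}) (A : 'I_m -> set Omega),
     (forall l, measurable (A l)) ->
     Pr [set w | forall l, l \in S -> A l (t l w)] =
       (\prod_(l in S) Pr (t l @^-1` A l))%E).

End BoundedFunctions.

(* Main.v *)
(* Applying the quasi-projection to near-best approximants of f and passing to a
   limit gives z in C^J*, with at most s = kappa n nonzero entries, such that
   |f - sum_j z_j b_j| <= eta everywhere. So z is feasible, and v = x# - z satisfies
   |v|_1 <= 2 sqrt(s) |v|_2 while sum_j v_j b_j has empirical norm at most 2 eta.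
   It suffices to bound the empirical norm from below by c |v|_2 on this cone.

   Such v are 2^p = O(sqrt s) times convex combinations of signed unit vectors.
   Cut |Re (sum_j v_j b_j)| into its layers between K 2^j and K 2^(j+1), j < p,
   and the part below K. On a layer of height h the function is close, both in
   L^2(mu) and in empirical L^2, to the same layer of an average of
   k = O(p 4^(p-j)) dictionary elements (Maurey), with an error controlled by the
   second moments of the dictionary. There are only |D|^k such averages, and
   Chernoff's bound exp(-c m w / h^2) for layers of mass at least w survives the
   union bound. Layers of smaller mass are negligible in total, and the remaining
   ones add up to a constant fraction of the norm. *)

Require Import Defs.
From HB Require Import structures.
From mathcomp Require Import all_boot all_order all_algebra finmap.
From mathcomp Require Import complex.
From mathcomp Require Import ring lra zify.
From mathcomp Require Import all_classical all_reals all_analysis.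
From mathcomp Require Import measurable_realfun.

Set Implicit Arguments.
Unset Strict Implicit.
Unset Printing Implicit Defensive.

Import Order.TTheory GRing.Theory Num.Theory.
Import numFieldNormedType.Exports.

Local Open Scope classical_set_scope.
Local Open Scope complex_scope.
Local Open Scope ring_scope.

(** * Exponential inequalities *)

Section Exponential.
Variable R : realType.
Implicit Types x a : R.

(** The sup norm is the obstacle: on the cone it can reach K 2^p, and a Chernoff bound with this
    range cannot pay for a family of averages fine enough for the whole function. Cutting by height
    balances the two sides. If a level of height h is approximated by k elements, the union bound
    costs k log |D| and Chernoff yields m w / h^2; the choice of k keeps k h^2 equal to p K^2 4^p up
    to a constant on every level, so each level asks for the same m, and w of order 1/p leads to K^2
    4^p p^2 log |D|. The Maurey error is kept in terms of pointwise second moments of the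
    dictionary, whose integrals are at most 1 and whose empirical means are at most 2, rather than
    in terms of K^2. Only a lower bound on the empirical norm is proved, which is why light levels
    can simply be dropped. The good event is a finite list of conditions on the sample points alone:
    it is measurable, and it serves all f and every selection of minimizers at once. *)

Lemma expR_ge_quadratic x : 0 <= x -> x ^+ 2 / 2 <= expR x.
Proof. by move=> x0; have := expR_ge1Dxn 1 x0; rewrite -[1.+1`!]/2%N; lra. Qed.

(** Squaring [expR (x / 2) <= 1 / (1 - x / 2)] leaves a polynomial inequality; for |x| <= 1/4 its
    remainder 1 - 3x + x^2 is positive. *)
Lemma expR_le_quadratic x : `|x| <= 1 / 4 -> expR x <= 1 + x + x ^+ 2.
Proof.
rewrite ler_norml => /andP[x1 x2].
have y0 : 0 < 1 - x / 2 by lra.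
have le1 : expR (x / 2) <= (1 - x / 2)^-1.
  rewrite -[expR _]invrK -expRN lef_pV2 ?posrE ?expR_gt0//.
  by have := expR_ge1Dx (- (x / 2)); lra.
have -> : expR x = expR (x / 2) ^+ 2 by rewrite -expRM_natr; congr expR; lra.
apply: (@le_trans _ _ ((1 - x / 2)^-1 ^+ 2)).
  by rewrite ler_pXn2r// nnegrE ?invr_ge0 ?expR_ge0// ltW.
rewrite exprVn -[leLHS]mul1r ler_pdivrMr ?exprn_gt0// mulrC.
have e : (1 - x / 2) ^+ 2 * (1 + x + x ^+ 2)
    = 1 + x ^+ 2 * (1 - 3 * x + x ^+ 2) / 4 by field.
rewrite e lerDl; apply: divr_ge0 => //; apply: mulr_ge0; first exact: sqr_ge0.
nra.
Qed.

(* The tangent of exp at a x lies below exp at both x and 0. *)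
Lemma expR_chord a x : 0 <= a <= 1 -> expR (a * x) - 1 <= a * (expR x - 1).
Proof.
move=> /andP[a0 a1].
have t1 : expR (a * x) * (1 + (1 - a) * x) <= expR x.
  have -> : expR x = expR (a * x + (1 - a) * x) by congr expR; lra.
  by rewrite expRD ler_wpM2l ?expR_ge0// expR_ge1Dx.
have t2 : expR (a * x) * (1 - a * x) <= 1.
  rewrite -[leRHS](expRxMexpNx_1 (a * x)) ler_wpM2l ?expR_ge0//.
  exact: expR_ge1Dx.
have a1' : 0 <= 1 - a by lra.
by have := ler_wpM2l a0 t1; have := ler_wpM2l a1' t2; lra.
Qed.

End Exponential.

(** * The empirical method of Maurey *)

Section ExcessCosh.
Variable R : realType.
Implicit Types x y a lam : R.

(* Subtracting 2 makes the bound on exponential moments proportional to the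
   variance: this is what keeps log K out of the sample complexity. *)
Definition cosh_excess x := expR x + expR (- x) - 2.

Lemma cosh_excessE_norm x : cosh_excess x = cosh_excess `|x|.
Proof.
by rewrite /cosh_excess; case: (ger0P x) => // _; rewrite opprK (addrC (expR x)).
Qed.

(** Halving the argument gives e^y >= (1 + y/2)^2, and (1 + y/2)^2 + (1 - y) - 2 is exactly
    y^2/4. *)
Lemma cosh_excess_ge_sq x : x ^+ 2 / 4 <= cosh_excess x.
Proof.
rewrite cosh_excessE_norm -(real_normK (num_real x)); have := normr_ge0 x.
move: `|x| => y y0; rewrite /cosh_excess.
have e1 : expR y = expR (y / 2) ^+ 2 by rewrite -expRM_natr; congr expR; lra.
have := expR_ge1Dx (- y); have := expR_ge1Dx (y / 2); rewrite e1.
nra.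
Qed.

Lemma cosh_excess_ge0 x : 0 <= cosh_excess x.
Proof. by apply: le_trans (cosh_excess_ge_sq x); rewrite divr_ge0// sqr_ge0. Qed.

(** One half of the exponential growth dominates the square, the other half supplies the decay
    factor. The condition [3 <= lam * a] forces e^y >= 4 on the tail, so the 2 subtracted in
    [cosh_excess] costs at most half of e^y. *)
Lemma sq_tail_le_cosh_excess lam a x : 0 < lam -> 3 <= lam * a ->
  (if a <= `|x| then x ^+ 2 else 0)
  <= 16 / lam ^+ 2 * expR (- (lam * a / 2)) * cosh_excess (lam * x).
Proof.
move=> lam0 la; case: ifPn => [ax|_]; last first.
  by rewrite !mulr_ge0 ?cosh_excess_ge0 ?expR_ge0 ?invr_ge0 ?sqr_ge0.
rewrite cosh_excessE_norm normrM (gtr0_norm lam0) -(real_normK (num_real x)).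
have lx : lam * a <= lam * `|x| by rewrite ler_wpM2l// ltW.
have -> : `|x| ^+ 2 = (lam * `|x|) ^+ 2 / lam ^+ 2.
  by rewrite exprMn mulrAC divff ?mul1r// sqrf_eq0 gt_eqF.
set E := expR (- (lam * a / 2)).
move: (lam * `|x|) lx => y lx; rewrite [leLHS]mulrC mulrAC -!mulrA mulrCA.
rewrite ler_wpM2l ?invr_ge0 ?sqr_ge0//.
have y3 : 3 <= y by lra.
have q : (y / 2) ^+ 2 / 2 <= expR (y / 2) by apply: expR_ge_quadratic; lra.
have e1 : expR y <= 2 * cosh_excess y.
  rewrite /cosh_excess; have := expR_ge1Dx y; have := expR_ge0 (- y); lra.
have e2 : expR (y / 2) <= expR y * E.
  by rewrite -expRD ler_expR; lra.
have := ler_wpM2r (expR_ge0 (- (lam * a / 2))) e1; rewrite -/E.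
by move: q e2; lra.
Qed.

End ExcessCosh.

Section EmpiricalMethod.
Variables (R : realType) (D : finType) (pr : D -> R) (k : nat).
Hypotheses (pr_ge0 : forall d, 0 <= pr d) (pr_sum1 : \sum_d pr d = 1).
Hypothesis k_gt0 : (0 < k)%N.

(** The law of k independent draws from [pr], encoded as weights on a finite type: its expectations
    are finite sums, which commute with integrals and empirical means. *)
Definition tuple_weight (t : {ffun 'I_k -> D}) : R := \prod_i pr (t i).

Definition tuple_mean (y : D -> R) (t : {ffun 'I_k -> D}) : R :=
  (\sum_i y (t i)) / k%:R.

Lemma tuple_weight_ge0 t : 0 <= tuple_weight t.
Proof. exact: prodr_ge0. Qed.

Lemma sum_tuple_weight_prod (F : D -> R) :
  \sum_t tuple_weight t * \prod_i F (t i) = (\sum_d pr d * F d) ^+ k.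
Proof.
transitivity (\prod_(i < k) \sum_d pr d * F d); last first.
  by rewrite prodr_const card_ord.
by rewrite bigA_distr_bigA; apply: eq_bigr => t _; rewrite -big_split.
Qed.

Lemma tuple_weight_sum1 : \sum_t tuple_weight t = 1.
Proof.
have := sum_tuple_weight_prod (fun=> 1).
rewrite (eq_bigr tuple_weight) => [->|t _]; last by rewrite big1// mulr1.
by rewrite (eq_bigr pr) ?pr_sum1 ?expr1n// => d _; rewrite mulr1.
Qed.

Lemma exists_le_tuple_mean (F : {ffun 'I_k -> D} -> R) (e : R) :
  \sum_t tuple_weight t * F t <= e -> exists t, F t <= e.
Proof.
move=> le_e; apply: contrapT => /forallNP H.
have : \sum_t tuple_weight t * e < \sum_t tuple_weight t * F t.
  have [t t0] : exists t, 0 < tuple_weight t.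
    apply: contrapT => /forallNP H0; have := tuple_weight_sum1.
    rewrite big1 => [/eqP|t _]; first by rewrite eq_sym oner_eq0.
    apply/eqP; rewrite eq_le tuple_weight_ge0 andbT leNgt.
    exact/negP.
  rewrite (bigD1 t)//= [ltRHS](bigD1 t)//= ltr_leD//.
    by rewrite ltr_pM2l// ltNge; apply/negP.
  apply: ler_sum => i _; rewrite ler_wpM2l ?tuple_weight_ge0//.
  by rewrite ltW// ltNge; apply/negP.
by rewrite -mulr_suml tuple_weight_sum1 mul1r ltNge le_e.
Qed.

Variables (y : D -> R) (B : R).
Hypotheses (B_gt0 : 0 < B) (y_le : forall d, `|y d| <= B).

Let f := \sum_d pr d * y d.
Let v := \sum_d pr d * y d ^+ 2.

Lemma weighted_mean_le : `|f| <= B.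
Proof.
apply: (le_trans (ler_norm_sum _ _ _)); rewrite -[leRHS]mul1r -pr_sum1 mulr_suml.
by apply: ler_sum => d _; rewrite normrM ger0_norm// ler_wpM2l.
Qed.

Lemma weighted_sq_le : v <= B ^+ 2.
Proof.
rewrite -[leRHS]mul1r -pr_sum1 mulr_suml.
apply: ler_sum => d _; rewrite ler_wpM2l// -(real_normK (num_real (y d))).
by rewrite ler_pXn2r// nnegrE ltW.
Qed.

Lemma weighted_sq_ge0 : 0 <= v.
Proof. by apply: sumr_ge0 => d _; rewrite mulr_ge0// sqr_ge0. Qed.

Lemma tuple_mgf_le lam : `|lam| * (2 * B) / k%:R <= 1 / 4 ->
  \sum_t tuple_weight t * expR (lam * (tuple_mean y t - f))
    <= expR (lam ^+ 2 * v / k%:R).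
Proof.
move=> lamB; have k0 : 0 < k%:R :> R by rewrite ltr0n.
pose mu := lam / k%:R.
have -> : \sum_t tuple_weight t * expR (lam * (tuple_mean y t - f))
    = (\sum_d pr d * expR (mu * (y d - f))) ^+ k.
  rewrite -sum_tuple_weight_prod; apply: eq_bigr => t _; congr (_ * _).
  rewrite -expR_sum -mulr_sumr big_split/= sumr_const card_ord; congr expR.
  rewrite /mu /tuple_mean -mulr_natr; field; lra.
have -> : lam ^+ 2 * v / k%:R = (mu ^+ 2 * v) * k%:R by rewrite /mu; field; lra.
rewrite expRM_natr ler_pXn2r ?nnegrE ?expR_ge0//; last first.
  by apply: sumr_ge0 => d _; rewrite mulr_ge0// expR_ge0.
apply: le_trans (expR_ge1Dx _).
apply: (@le_trans _ _ (\sum_d pr d * (1 + mu * (y d - f) + (mu * (y d - f)) ^+ 2))).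
  apply: ler_sum => d _; rewrite ler_wpM2l//; apply: expR_le_quadratic.
  apply: le_trans lamB; rewrite normrM /mu normrM (@ger0_norm _ k%:R^-1).
    rewrite mulrAC ler_wpM2r ?invr_ge0 ?(ltW k0)// ler_wpM2l//.
    apply: (le_trans (ler_normB _ _)); rewrite mulr_natl mulr2n.
    by rewrite lerD// weighted_mean_le.
  by rewrite invr_ge0 ltW.
(* The linear term has mean zero and the quadratic one has mean mu^2 (v - f^2), whose negative part
   is dropped. *)
have -> : \sum_d pr d * (1 + mu * (y d - f) + (mu * (y d - f)) ^+ 2)
   = (1 - mu * f + mu ^+ 2 * f ^+ 2) * \sum_d pr d
     + (mu - 2 * mu ^+ 2 * f) * f + mu ^+ 2 * v.
  transitivity (\sum_d ((1 - mu * f + mu ^+ 2 * f ^+ 2) * pr d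
      + (mu - 2 * mu ^+ 2 * f) * (pr d * y d) + mu ^+ 2 * (pr d * y d ^+ 2))).
    by apply: eq_bigr => d _; ring.
  by rewrite !big_split/= -!mulr_sumr.
rewrite pr_sum1; have := sqr_ge0 (mu * f); lra.
Qed.

Lemma tuple_cosh_excess_le lam : `|lam| * (2 * B) / k%:R <= 1 / 4 ->
  \sum_t tuple_weight t * cosh_excess (lam * (tuple_mean y t - f))
    <= 2 * (expR (lam ^+ 2 * v / k%:R) - 1).
Proof.
move=> lamB; have h1 := tuple_mgf_le lamB.
have := lamB; rewrite -normrN => /tuple_mgf_le; rewrite sqrrN => h2.
have -> : \sum_t tuple_weight t * cosh_excess (lam * (tuple_mean y t - f))
  = \sum_t tuple_weight t * expR (lam * (tuple_mean y t - f))
  + \sum_t tuple_weight t * expR (- lam * (tuple_mean y t - f))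
  - 2 * \sum_t tuple_weight t.
  rewrite mulr_sumr -big_split -sumrB/=; apply: eq_bigr => t _.
  by rewrite /cosh_excess mulNr; ring.
by rewrite tuple_weight_sum1; lra.
Qed.

(** Since [cosh_excess] dominates a quarter of the square, the variance can be read off the
    exponential moment; the constant 16 is the price for avoiding cross terms. *)
Lemma tuple_variance_le :
  \sum_t tuple_weight t * (tuple_mean y t - f) ^+ 2 <= 16 * v / k%:R.
Proof.
have k1 : 1 <= k%:R :> R by rewrite ler1n.
(* This value is admissible for every k >= 1 and keeps the exponent lam^2 v / k at most 1/64. *)
pose lam := Num.sqrt k%:R / (8 * B).
have sk2 : Num.sqrt k%:R ^+ 2 = k%:R :> R by rewrite sqr_sqrtr.
have sk1 : 1 <= Num.sqrt k%:R :> R by rewrite -[leLHS]sqrtr1 ler_wsqrtr.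
have lamB : `|lam| * (2 * B) / k%:R <= 1 / 4.
  rewrite ger0_norm; last by rewrite divr_ge0 ?sqrtr_ge0 ?mulr_ge0 ?(ltW B_gt0).
  rewrite /lam -{2}sk2.
  have -> : Num.sqrt k%:R / (8 * B) * (2 * B) / Num.sqrt k%:R ^+ 2
     = (Num.sqrt k%:R)^-1 / 4 :> R by field; apply/andP; split; rewrite gt_eqF//; lra.
  by rewrite ler_wpM2r ?invr_ge0// invf_le1//; lra.
have l2 : lam ^+ 2 = k%:R / (64 * B ^+ 2).
  rewrite /lam expr_div_n sk2; congr (_ / _); ring.
have l20 : 0 < lam ^+ 2 by rewrite l2 divr_gt0 ?mulr_gt0 ?exprn_gt0//; lra.
have e1 : lam ^+ 2 * v / k%:R = v / (64 * B ^+ 2).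
  by rewrite l2; field; apply/andP; split; rewrite gt_eqF//; lra.
have e2 : v / (64 * B ^+ 2) <= 1 / 64.
  rewrite ler_pdivrMr ?mulr_gt0 ?exprn_gt0//; have := weighted_sq_le; lra.
have e3 : 0 <= v / (64 * B ^+ 2).
  by rewrite divr_ge0 ?weighted_sq_ge0// mulr_ge0// sqr_ge0.
have := tuple_cosh_excess_le lamB; rewrite e1.
have := @expR_le_quadratic R (v / (64 * B ^+ 2)); rewrite ger0_norm// => /(_ _) q.
have {}q := q ltac:(lra).
have e4 := ler_wpM2r e3 e2.
move=> h.
have h' : lam ^+ 2 / 4 * \sum_t tuple_weight t * (tuple_mean y t - f) ^+ 2
   <= 4 * (v / (64 * B ^+ 2)).
  apply: (@le_trans _ _ (2 * (expR (v / (64 * B ^+ 2)) - 1))); last by move: q e3 e4; rewrite expr2; lra.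
  apply: le_trans h; rewrite mulr_sumr; apply: ler_sum => t _.
  rewrite mulrCA ler_wpM2l ?tuple_weight_ge0//.
  by apply: le_trans (cosh_excess_ge_sq _); rewrite mulrAC -exprMn.
have -> : 16 * v / k%:R = (lam ^+ 2 / 4)^-1 * (4 * (v / (64 * B ^+ 2))).
  by rewrite l2; field; apply/andP; split; rewrite gt_eqF//; lra.
rewrite -ler_pdivrMl ?invr_gt0 ?divr_gt0// invrK//.
Qed.

(** [expR_chord] with a = v / B^2 moves v out of the exponent. Being linear in v, the bound can
    later be integrated, where the second moments of the dictionary are under control. *)
Lemma tuple_sq_tail_le lam a : 0 < lam -> 3 <= lam * a ->
  lam * (2 * B) / k%:R <= 1 / 4 ->
  \sum_t tuple_weight t *
    (if a <= `|tuple_mean y t - f| then (tuple_mean y t - f) ^+ 2 else 0)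
  <= 32 / lam ^+ 2 * expR (- (lam * a / 2))
     * (v / B ^+ 2 * (expR (lam ^+ 2 * B ^+ 2 / k%:R) - 1)).
Proof.
move=> lam0 la lamB.
have k0 : 0 < k%:R :> R by rewrite ltr0n.
have := @tuple_cosh_excess_le lam; rewrite gtr0_norm// => /(_ lamB) h.
apply: (@le_trans _ _ (16 / lam ^+ 2 * expR (- (lam * a / 2)) *
   \sum_t tuple_weight t * cosh_excess (lam * (tuple_mean y t - f)))).
  rewrite mulr_sumr; apply: ler_sum => t _.
  by rewrite mulrCA ler_wpM2l ?tuple_weight_ge0// sq_tail_le_cosh_excess.
have -> : 32 / lam ^+ 2 * expR (- (lam * a / 2))
     * (v / B ^+ 2 * (expR (lam ^+ 2 * B ^+ 2 / k%:R) - 1))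
  = 16 / lam ^+ 2 * expR (- (lam * a / 2))
     * (2 * (v / B ^+ 2 * (expR (lam ^+ 2 * B ^+ 2 / k%:R) - 1))) by lra.
rewrite ler_wpM2l ?mulr_ge0 ?expR_ge0 ?invr_ge0 ?sqr_ge0//.
apply: (le_trans h); rewrite ler_wpM2l//.
have -> : lam ^+ 2 * v / k%:R = (v / B ^+ 2) * (lam ^+ 2 * B ^+ 2 / k%:R).
  by field; apply/andP; split; rewrite gt_eqF//; lra.
apply: expR_chord; rewrite divr_ge0 ?weighted_sq_ge0 ?sqr_ge0//=.
by rewrite ler_pdivrMr ?exprn_gt0// mul1r weighted_sq_le.
Qed.

End EmpiricalMethod.

(** * Dyadic levels *)

Section Levels.
Variable R : realType.
Implicit Types K h x y : R.

Definition clip h x := Num.min `|x| h.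

Definition layer h x := clip (2 * h) x - clip h x.

Definition level K i x :=
  if i is j.+1 then layer (K * 2 ^+ j) x else clip K x.

(** The truncated predecessor gives levels 0 and 1 the same height K: the clipped part and the first
    layer both have range K. *)
Definition height K i : R := K * 2 ^+ i.-1.

Lemma height_gt0 K i : 0 < K -> 0 < height K i.
Proof. by move=> K0; rewrite mulr_gt0// exprn_gt0. Qed.

Lemma clip_lipschitz h x y : `|clip h x - clip h y| <= `|x - y|.
Proof.
have := ler_dist_dist x y; rewrite /clip.
move: `|x - y| => z; rewrite !ler_norml => /andP[? ?].
by case: (leP `|x| h); case: (leP `|y| h) => *; apply/andP; split; lra.
Qed.

Lemma layer_lipschitz h x y : `|layer h x - layer h y| <= `|x - y|.
Proof.
have := ler_dist_dist x y; rewrite /layer /clip.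
have := normr_ge0 x; have := normr_ge0 y.
move: `|x - y| => z ? ?; rewrite !ler_norml => /andP[? ?].
by case: (leP `|x| h); case: (leP `|y| h); case: (leP `|x| (2 * h));
  case: (leP `|y| (2 * h)) => *; apply/andP; split; lra.
Qed.

Lemma level_lipschitz K i x y : `|level K i x - level K i y| <= `|x - y|.
Proof. by case: i => [|i]; [exact: clip_lipschitz|exact: layer_lipschitz]. Qed.

Lemma level_bounds K i x : 0 < K -> 0 <= level K i x <= height K i.
Proof.
move=> K0; have x0 := normr_ge0 x.
case: i => [|i]; rewrite /height /level /layer /clip /= ?expr0 ?mulr1.
  by case: (leP `|x| K) => *; apply/andP; split; lra.
have : 0 < K * 2 ^+ i by rewrite mulr_gt0// exprn_gt0.
move: (K * _) => h h0.
by case: (leP `|x| h); case: (leP `|x| (2 * h)) => *; apply/andP; split; lra.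
Qed.

Lemma sum_level K p x : \sum_(i < p.+1) level K i x = clip (K * 2 ^+ p) x.
Proof.
elim: p => [|p IHp]; first by rewrite big_ord1 /= expr0 mulr1.
by rewrite big_ord_recr/= IHp /layer exprS mulrCA; ring.
Qed.

Lemma sum_sqr_level_le K p x : 0 < K -> \sum_(i < p.+1) level K i x ^+ 2 <= x ^+ 2.
Proof.
move=> K0; rewrite -(real_normK (num_real x)).
have lv0 i : 0 <= level K i x by have /andP[] := level_bounds i x K0.
have s0 q : 0 <= \sum_(i < q) level K i x by rewrite sumr_ge0.
apply: (@le_trans _ _ ((\sum_(i < p.+1) level K i x) ^+ 2)).
  elim: p.+1 => [|q IHq]; first by rewrite !big_ord0 expr0n.
  by rewrite !big_ord_recr/=; have := lv0 q; have := s0 q; nra.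
by rewrite ler_pXn2r ?nnegrE// sum_level /clip ge_min lexx.
Qed.

(** The layer containing |x| may be almost empty, but the one below it is full and its height is at
    least |x| / 4; hence 16. For |x| <= 2 K, [clip K x] alone is at least |x| / 2. *)
Lemma sqr_le_sum_sqr_level K p x : 0 < K -> `|x| <= K * 2 ^+ p -> (0 < p)%N ->
  x ^+ 2 <= 16 * \sum_(i < p.+1) level K i x ^+ 2.
Proof.
move=> K0 + p0; case: p p0 => // p _; rewrite -(real_normK (num_real x)).
have x0 := normr_ge0 x.
elim: p => [|p IHp] xle.
  rewrite 2!big_ord_recl big_ord0 /= addr0.
  apply: (@le_trans _ _ (16 * level K 0 x ^+ 2)).
    move: xle; rewrite expr1 /= /clip; case: (leP `|x| K) => *; nra.
  by have := sqr_ge0 (layer (K * 2 ^+ 0) x); rewrite /=; lra.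
rewrite big_ord_recr/=; have [xle'|xgt] := leP `|x| (K * 2 ^+ p.+1).
  have := IHp xle'; have := sqr_ge0 (layer (K * 2 ^+ p.+1) x); lra.
apply: (@le_trans _ _ (16 * level K p.+1 x ^+ 2)).
  have : 0 < K * 2 ^+ p by rewrite mulr_gt0// exprn_gt0.
  have e1 : K * 2 ^+ p.+1 = 2 * (K * 2 ^+ p) by rewrite exprS; ring.
  have e2 : K * 2 ^+ p.+2 = 4 * (K * 2 ^+ p) by rewrite !exprSr; ring.
  move: xle xgt; rewrite /= /layer /clip e1 e2; move: (K * 2 ^+ p) => h xle xgt h0.
  by rewrite !min_r; [nra|lra..].
have s0 : 0 <= \sum_(i < p.+1) level K i x ^+ 2.
  by apply: sumr_ge0 => i _; exact: sqr_ge0.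
have -> : \sum_(i < p.+2) (level K i x) ^+ 2
    = \sum_(i < p.+1) level K i x ^+ 2 + level K p.+1 x ^+ 2.
  by rewrite big_ord_recr.
have := sqr_ge0 (layer (K * 2 ^+ p.+1) x); lra.
Qed.

(** If |y| and |x - y| are both below h / 2, then |x| < h and both layers vanish. The first term
    will be treated by the variance, the second as a large deviation. *)
Lemma layer_sub_sqr_le h x y : 0 < h -> (layer h x - layer h y) ^+ 2 <=
  (if h / 2 <= `|y| then (x - y) ^+ 2 else 0)
  + (if h / 2 <= `|x - y| then (x - y) ^+ 2 else 0).
Proof.
move=> h0.
have lip : (layer h x - layer h y) ^+ 2 <= (x - y) ^+ 2.
  rewrite -(real_normK (num_real (layer h x - _))) -(real_normK (num_real (x - y))).
  by rewrite ler_pXn2r ?nnegrE// layer_lipschitz.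
have sq0 := sqr_ge0 (x - y).
case: (leP (h / 2) `|y|) => hy; case: (leP (h / 2) `|x - y|) => hxy; try lra.
have hx : `|x| < h.
  by have := ler_normD (x - y) y; rewrite subrK; lra.
rewrite /layer /clip !min_l; [by rewrite !subrr expr0n addr0|lra..].
Qed.

End Levels.

Lemma expr4n (R : realType) n : 4 ^+ n = 2 ^+ n * 2 ^+ n :> R.
Proof. by rewrite -exprMn -natrM. Qed.

(** * Maurey's error on a single level *)

Section LevelError.
Variables (R : realType) (D : finType) (pr : D -> R).
Hypotheses (pr_ge0 : forall d, 0 <= pr d) (pr_sum1 : \sum_d pr d = 1).
Variables (K : R) (u : D -> R) (A p : nat).
Hypotheses (K_gt0 : 0 < K) (u_le : forall d, `|u d| <= K).
Hypotheses (A_ge : 2 ^+ 21 <= A%:R :> R) (p_gt0 : (0 < p)%N).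

(** The product of this size and the squared height is A p K^2 4^p on every level, so entropy and
    Chernoff exponent scale alike. The factor p lets the tail estimate decay like e^(-32 p), which
    absorbs 4^p. *)
Definition level_size (A p i : nat) : nat := (A * p * 4 ^ (p - i.-1))%N.

Let y d := 2 ^+ p * u d.
Let f := \sum_d pr d * y d.
Let q := \sum_d pr d * u d ^+ 2.

Let A_gt0 : 0 < A%:R :> R.
Proof. by apply: lt_le_trans A_ge; rewrite exprn_gt0. Qed.

Let p_ge1 : 1 <= p%:R :> R.
Proof. by rewrite ler1n. Qed.

Let p_pos : 0 < p%:R :> R.
Proof. by rewrite ltr0n. Qed.

Let q_ge0 : 0 <= q.
Proof. by apply: sumr_ge0 => d _; rewrite mulr_ge0// sqr_ge0. Qed.

Let y_le d : `|y d| <= K * 2 ^+ p.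
Proof. by rewrite normrM ger0_norm ?exprn_ge0// mulrC ler_wpM2r ?exprn_ge0. Qed.

Let B_gt0 : 0 < K * 2 ^+ p.
Proof. by rewrite mulr_gt0// exprn_gt0. Qed.

Let size_gt0 i : (0 < level_size A p i)%N.
Proof.
rewrite /level_size !muln_gt0 p_gt0 expn_gt0 !andbT.
by move: A_gt0; rewrite ltr0n.
Qed.

Let sizeE i : (level_size A p i)%:R = A%:R * p%:R * 4 ^+ (p - i.-1) :> R.
Proof. by rewrite /level_size !natrM natrX. Qed.

Let varE : \sum_d pr d * y d ^+ 2 = 4 ^+ p * q.
Proof.
rewrite /q mulr_sumr; apply: eq_bigr => d _.
by rewrite /y exprMn expr4n; ring.
Qed.

Let sqr_lip i x z : (level K i x - level K i z) ^+ 2 <= (x - z) ^+ 2.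
Proof.
rewrite -(real_normK (num_real (_ - level _ _ _))) -(real_normK (num_real (x - z))).
by rewrite ler_pXn2r ?nnegrE// level_lipschitz.
Qed.

Lemma truncation_mean_error :
  \sum_t tuple_weight pr t *
    (level K 0 (tuple_mean (k := level_size A p 0) y t) - level K 0 f) ^+ 2
  <= q / (2 ^+ 17 * p%:R).
Proof.
apply: (@le_trans _ _ (16 * (4 ^+ p * q) / (level_size A p 0)%:R)).
  rewrite -varE; apply: le_trans (tuple_variance_le pr_ge0 pr_sum1 _ B_gt0 y_le) => //.
  by apply: ler_sum => t _; rewrite ler_wpM2l ?tuple_weight_ge0.
rewrite sizeE /= subn0.
have -> : 16 * (4 ^+ p * q) / (A%:R * p%:R * 4 ^+ p) = q / p%:R * (16 / A%:R) :> R.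
  by field; rewrite !gt_eqF ?exprn_gt0//.
have -> : q / (2 ^+ 17 * p%:R) = q / p%:R * (2 ^+ 17)^-1.
  by field; rewrite !gt_eqF ?exprn_gt0//.
rewrite ler_wpM2l ?divr_ge0//.
rewrite ler_pdivrMr// mulrC ler_pdivlMr ?exprn_gt0//.
(* Here the lower bound on [A] is used in full: 2^4 * 2^17 = 2^21. *)
by apply: le_trans A_ge; rewrite (_ : 16 = 2 ^+ 4) -?exprD//; ring.
Qed.

(** With E = e^p >= 2^p, the left side is at most E^2 E^(-32) E = E^(-29). *)
Lemma exp_decay_le : 4 ^+ p * expR (- (32 * p%:R)) * (expR p%:R - 1) <= (2 ^+ 20)^-1 :> R.
Proof.
set E := expR p%:R.
have e2 : 2 <= expR 1 :> R by have := expR_ge1Dx (1 : R); lra.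
have E2 : 2 ^+ p <= E by rewrite /E -[p%:R]mul1r expRM_natr ler_pXn2r ?nnegrE ?expR_ge0.
have E1 : 2 <= E.
  by apply: (le_trans _ E2); rewrite -[leLHS]expr1 ler_eXn2l ?ltr1n.
have E0 : 0 < E by lra.
have -> : expR (- (32 * p%:R)) = (E ^+ 32)^-1.
  by rewrite /E -expRM_natl expRN.
apply: (@le_trans _ _ (E ^+ 2 * (E ^+ 32)^-1 * E)).
  apply: ler_pM; [| by lra | |by lra].
    by rewrite mulr_ge0 ?exprn_ge0 ?invr_ge0// exprn_ge0// ltW.
  apply: ler_wpM2r; first by rewrite invr_ge0 exprn_ge0// ltW.
  by rewrite expr4n expr2; apply: ler_pM.
have -> : E ^+ 2 * (E ^+ 32)^-1 * E = (E ^+ 29)^-1 by field; rewrite gt_eqF.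
rewrite lef_pV2 ?posrE ?exprn_gt0//.
apply: (@le_trans _ _ (2 ^+ 29)); first by rewrite ler_eXn2l ?ltr1n.
by rewrite ler_pXn2r ?nnegrE// ltW.
Qed.

(** The variance bound alone exceeds the claim by a factor of order 4^j, because high layers use few
    draws. Where |f| >= h / 2 this is repaid by f^2, as q <= K^2 and 4^j K^2 = h^2 <= 4 f^2.
    Elsewhere only deviations of at least h / 2 count, and these are exponentially rare in p. *)
Lemma layer_mean_error (j : nat) : (j < p)%N ->
  \sum_t tuple_weight pr t *
    (level K j.+1 (tuple_mean (k := level_size A p j.+1) y t) - level K j.+1 f) ^+ 2
  <= (f ^+ 2 / 2 ^+ 15 + q / 2 ^+ 17) / p%:R.
Proof.
move=> jp.
set k := level_size A p j.+1; set h := K * 2 ^+ j.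
have h0 : 0 < h by rewrite mulr_gt0// exprn_gt0.
have k0 : 0 < k%:R :> R by rewrite ltr0n; exact: size_gt0.
pose r : R := 2 ^+ (p - j).
have r1 : 1 <= r by rewrite /r exprn_ege1// ler1n.
have pj : 2 ^+ p = 2 ^+ j * r :> R by rewrite /r -exprD subnKC// ltnW.
have kE : k%:R = A%:R * p%:R * (r * r) :> R by rewrite /k sizeE/= expr4n.
(* Chosen so that the decay exponent lam (h / 2) / 2 is 32 p, while the growth exponent lam^2 (K
   2^p)^2 / k is 2^14 p / A, at most p. *)
pose lam := 2 ^+ 7 * p%:R / h.
have lam0 : 0 < lam by rewrite divr_gt0// mulr_gt0// exprn_gt0.
have lamh : lam * (h / 2) = 64 * p%:R by rewrite /lam; field; rewrite gt_eqF.
have lamB : lam * (2 * (K * 2 ^+ p)) / k%:R <= 1 / 4.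
  rewrite kE pj.
  have -> : lam * (2 * (K * (2 ^+ j * r))) / (A%:R * p%:R * (r * r))
    = 2 ^+ 8 / (A%:R * r) by rewrite /lam /h; field; rewrite !gt_eqF ?exprn_gt0//.
  rewrite ler_pdivrMr ?mulr_gt0//; last by lra.
  by move: A_ge; rewrite !exprS expr0; nra.
have p3 : 3 <= 64 * p%:R :> R by have := p_ge1; lra.
have := tuple_sq_tail_le pr_ge0 pr_sum1 (size_gt0 j.+1) B_gt0 y_le lam0 _ lamB.
move=> /(_ (h / 2)); rewrite lamh => /(_ p3).
have := tuple_variance_le pr_ge0 pr_sum1 (size_gt0 j.+1) B_gt0 y_le.
rewrite varE -/f -/k => hvar htail.
have main : \sum_t tuple_weight pr t *
   (if h / 2 <= `|f| then (tuple_mean (k := k) y t - f) ^+ 2 else 0)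
   <= f ^+ 2 / 2 ^+ 15 / p%:R.
  case: (leP (h / 2) `|f|) => hf; last first.
    rewrite big1 => [|t _]; last by rewrite mulr0.
    by rewrite !divr_ge0 ?sqr_ge0 ?exprn_ge0//; lra.
  apply: (le_trans hvar).
  have qK : q <= K ^+ 2 by apply: weighted_sq_le.
  have hf2 : h ^+ 2 <= 4 * f ^+ 2.
    rewrite -(real_normK (num_real f)); nra.
  have -> : 16 * (4 ^+ p * q) / k%:R = q * (16 * (2 ^+ j * 2 ^+ j)) / (A%:R * p%:R).
    by rewrite kE expr4n pj; field; rewrite !gt_eqF ?exprn_gt0//.
  apply: (@le_trans _ _ (64 * f ^+ 2 / (A%:R * p%:R))).
    apply: ler_wpM2r; first by rewrite invr_ge0 mulr_ge0// ltW.
    apply: (@le_trans _ _ (16 * h ^+ 2)); last by lra.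
    rewrite /h exprMn -(expr2 (2 ^+ j)) mulrCA.
    by rewrite ler_wpM2l// ler_wpM2r ?sqr_ge0.
  rewrite invfM mulrA; apply: ler_wpM2r; first by rewrite invr_ge0 ltW.
  rewrite mulrC mulrA [leRHS]mulrC ler_wpM2r ?sqr_ge0//.
  rewrite mulrC ler_pdivrMr// mulrC ler_pdivlMr ?exprn_gt0//.
  by apply: le_trans A_ge; rewrite (_ : 64 = 2 ^+ 6) -?exprD//; ring.
have tail : \sum_t tuple_weight pr t * (if h / 2 <= `|tuple_mean (k := k) y t - f|
    then (tuple_mean y t - f) ^+ 2 else 0) <= q / 2 ^+ 17 / p%:R.
  apply: (le_trans htail).
  have -> : lam ^+ 2 * (K * 2 ^+ p) ^+ 2 / k%:R = (2 ^+ 7) ^+ 2 / A%:R * p%:R.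
    rewrite kE pj /lam /h; field; rewrite !gt_eqF ?exprn_gt0//.
  have -> : 64 * p%:R / 2 = 32 * p%:R :> R by field.
  have -> : 32 / lam ^+ 2 * expR (- (32 * p%:R)) *
    (4 ^+ p * q / (K * 2 ^+ p) ^+ 2 * (expR ((2 ^+ 7) ^+ 2 / A%:R * p%:R) - 1))
    = q / p%:R * ((2 ^+ 9 * p%:R)^-1 * (2 ^+ j * 2 ^+ j * expR (- (32 * p%:R))
         * (expR ((2 ^+ 7) ^+ 2 / A%:R * p%:R) - 1))).
    rewrite /lam /h expr4n; field; rewrite !gt_eqF ?exprn_gt0//.
  rewrite [leRHS]mulrAC; apply: ler_wpM2l; first by rewrite divr_ge0// ltW.
  have s1 : expR ((2 ^+ 7) ^+ 2 / A%:R * p%:R) - 1 <= expR p%:R - 1 :> R.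
    rewrite lerD2r ler_expR -[leRHS]mul1r; apply: ler_wpM2r; first exact: ltW.
    rewrite ler_pdivrMr// mul1r; apply: le_trans A_ge.
    by rewrite -exprM ler_eXn2l ?ltr1n.
  have s0 : 0 <= expR ((2 ^+ 7) ^+ 2 / A%:R * p%:R) - 1 :> R.
    rewrite subr_ge0 -[leLHS]expR0 ler_expR mulr_ge0 ?divr_ge0 ?exprn_ge0// ltW.
  have s2 : 2 ^+ j * 2 ^+ j <= 4 ^+ p :> R.
    by rewrite -expr4n ler_eXn2l ?ltr1n// ltnW.
  apply: (@le_trans _ _ (1 * (2 ^+ 20)^-1)); last first.
    by rewrite mul1r lef_pV2 ?posrE ?exprn_gt0// ler_eXn2l ?ltr1n.
  apply: ler_pM.
  - by rewrite invr_ge0 mulr_ge0 ?exprn_ge0// ltW.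
  - by rewrite !mulr_ge0 ?exprn_ge0 ?expR_ge0.
  - by rewrite invf_le1 ?mulr_gt0 ?exprn_gt0// mulr_ege1// exprn_ege1// ler1n.
  apply: le_trans exp_decay_le; apply: ler_pM => //.
  by rewrite ler_wpM2r ?expR_ge0.
rewrite mulrDl; apply: le_trans (lerD main tail).
rewrite -big_split/=; apply: ler_sum => t _.
rewrite -mulrDr ler_wpM2l ?tuple_weight_ge0//.
exact: layer_sub_sqr_le.
Qed.

Lemma level_mean_error i : (i <= p)%N ->
  \sum_t tuple_weight pr t *
    (level K i (tuple_mean (k := level_size A p i) y t) - level K i f) ^+ 2
  <= (f ^+ 2 / 2 ^+ 15 + q / 2 ^+ 17) / p%:R.
Proof.
case: i => [_|i ip]; last exact: layer_mean_error.
apply: (le_trans truncation_mean_error); rewrite invfM mulrA.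
apply: ler_wpM2r; first by rewrite invr_ge0 ltW.
by rewrite lerDr divr_ge0 ?sqr_ge0// exprn_ge0.
Qed.

End LevelError.

(** * Bounded measurable functions and empirical means *)

Section BoundedMeasurable.
Context d (T : measurableType d) (R : realType).
Implicit Types f g : T -> R.

(** On a probability space such functions are integrable, and they form an algebra stable under
    [level] and exp, so integrability side conditions reduce to closure lemmas. *)
Definition bmeas f := measurable_fun setT f /\ exists M, forall x, `|f x| <= M.

Lemma bmeas_cst (c : R) : bmeas (fun=> c).
Proof. by split; [exact: measurable_cst|exists `|c|]. Qed.

Lemma bmeasD f g : bmeas f -> bmeas g -> bmeas (fun x => f x + g x).
Proof.
move=> [mf [M Mf]] [mg [N Ng]]; split; first exact: measurable_funD.
by exists (M + N) => x; apply: le_trans (ler_normD _ _) (lerD _ _).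
Qed.

Lemma bmeasM f g : bmeas f -> bmeas g -> bmeas (fun x => f x * g x).
Proof.
move=> [mf [M Mf]] [mg [N Ng]]; split; first exact: measurable_funM.
by exists (M * N) => x; rewrite normrM ler_pM.
Qed.

Lemma bmeasZ (c : R) f : bmeas f -> bmeas (fun x => c * f x).
Proof. exact/bmeasM/bmeas_cst. Qed.

Lemma bmeasN f : bmeas f -> bmeas (fun x => - f x).
Proof.
by move=> /(bmeasZ (-1)); under eq_fun do rewrite mulN1r.
Qed.

Lemma bmeasB f g : bmeas f -> bmeas g -> bmeas (fun x => f x - g x).
Proof. by move=> bf /bmeasN; exact: bmeasD. Qed.

Lemma bmeas_sqr f : bmeas f -> bmeas (fun x => f x ^+ 2).
Proof. by move=> bf; under eq_fun do rewrite expr2; exact: bmeasM. Qed.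

Lemma bmeas_sum (I : Type) (s : seq I) (P : pred I) (F : I -> T -> R) :
  (forall i, bmeas (F i)) -> bmeas (fun x => \sum_(i <- s | P i) F i x).
Proof.
move=> bF; elim: s => [|i s IHs].
  by under eq_fun do rewrite big_nil; exact: bmeas_cst.
under eq_fun do rewrite big_cons.
by case: (P i) => //; exact: bmeasD.
Qed.

Lemma bmeas_level K i f : 0 < K -> bmeas f -> bmeas (fun x => level K i (f x)).
Proof.
move=> K0 [mf _]; split; last first.
  exists (height K i) => x; have /andP[l0 lh] := level_bounds i (f x) K0.
  by rewrite ger0_norm.
have mclip h : measurable_fun setT (fun x => clip h (f x)).
  apply: measurable_minr; last exact: measurable_cst.
  exact: (measurableT_comp (@normr_measurable R setT) mf).
by case: i => [|i]; [exact: mclip|apply: measurable_funB].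
Qed.

Variable mu : probability T R.

Lemma bmeas_integrable f : bmeas f -> mu.-integrable setT (EFin \o f).
Proof.
move=> [mf [M Mf]]; apply: measurable_bounded_integrable => //.
  by rewrite (le_lt_trans (probability_le1 mu measurableT))// ltry.
exists M; split; first exact: num_real.
by move=> y My x _; apply: le_trans (Mf x) (ltW My).
Qed.

Lemma bmeas_le_Rintegral f g : bmeas f -> bmeas g -> (forall x, f x <= g x) ->
  \int[mu]_x f x <= \int[mu]_x g x.
Proof. by move=> bf bg fg; apply: le_Rintegral => //; exact: bmeas_integrable. Qed.

Lemma bmeas_RintegralD f g : bmeas f -> bmeas g ->
  \int[mu]_x (f x + g x) = \int[mu]_x f x + \int[mu]_x g x.
Proof. by move=> bf bg; apply: RintegralD => //; exact: bmeas_integrable. Qed.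

Lemma bmeas_RintegralZ (c : R) f : bmeas f ->
  \int[mu]_x (c * f x) = c * \int[mu]_x f x.
Proof. by move=> bf; apply: RintegralZl => //; exact: bmeas_integrable. Qed.

Lemma Rintegral_prob_cst (c : R) : \int[mu]_x c = c.
Proof. by rewrite Rintegral_cst//; have /= -> := @probability_setT _ _ _ mu; rewrite mulr1. Qed.

Lemma bmeas_Rintegral_sum (I : Type) (s : seq I) (P : pred I) (F : I -> T -> R) :
  (forall i, bmeas (F i)) ->
  \int[mu]_x (\sum_(i <- s | P i) F i x) = \sum_(i <- s | P i) \int[mu]_x F i x.
Proof.
move=> bF; elim: s => [|i s IHs].
  rewrite big_nil; under eq_Rintegral do rewrite big_nil.
  exact: Rintegral_prob_cst.
rewrite big_cons; under eq_Rintegral do rewrite big_cons.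
case: (P i) => //; rewrite bmeas_RintegralD ?IHs//.
exact: bmeas_sum.
Qed.

End BoundedMeasurable.

Section EmpiricalMean.
Context (T : Type) (R : realType) (m : nat) (ts : 'I_m -> T).
Implicit Types f g : T -> R.

Definition emp_mean f : R := (\sum_(l < m) f (ts l)) / m%:R.

Lemma emp_mean_ge0 f : (forall x, 0 <= f x) -> 0 <= emp_mean f.
Proof. by move=> f0; rewrite divr_ge0// sumr_ge0. Qed.

Lemma le_emp_mean f g : (forall x, f x <= g x) -> emp_mean f <= emp_mean g.
Proof. by move=> fg; rewrite ler_wpM2r ?invr_ge0// ler_sum. Qed.

Lemma emp_meanD f g : emp_mean (fun x => f x + g x) = emp_mean f + emp_mean g.
Proof. by rewrite /emp_mean big_split mulrDl. Qed.

Lemma emp_meanZ (c : R) f : emp_mean (fun x => c * f x) = c * emp_mean f.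
Proof. by rewrite /emp_mean -mulr_sumr mulrA. Qed.

Lemma emp_mean_sum (I : Type) (s : seq I) (P : pred I) (F : I -> T -> R) :
  emp_mean (fun x => \sum_(i <- s | P i) F i x) = \sum_(i <- s | P i) emp_mean (F i).
Proof. by rewrite /emp_mean exchange_big/= mulr_suml. Qed.

End EmpiricalMean.

(** * Lower bounds for empirical norms *)

Section RestrictedLowerBound.
Context d (T : measurableType d) (R : realType) (mu : probability T R).
Context (m : nat) (ts : 'I_m -> T).
Variables (D : finType) (K : R) (u : D -> T -> R) (A p : nat).
Hypotheses (K_gt0 : 0 < K) (u_le : forall j x, `|u j x| <= K).
Hypotheses (u_bmeas : forall j, bmeas (u j)).
Hypotheses (A_ge : 2 ^+ 21 <= A%:R :> R) (p_gt0 : (0 < p)%N).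

(* The summand 1/p pays for the entropy of level i, the summand 2^-(p-i+1) for
   the failure probability; both are summable over the p + 1 levels. *)
Definition threshold (p i : nat) : R :=
  ((2 ^+ (p - i.-1))^-1 + p%:R^-1) / 2 ^+ 8.

Definition sample_mean k (t : {ffun 'I_k -> D}) (x : T) : R :=
  tuple_mean (fun j => 2 ^+ p * u j x) t.

Lemma threshold_ge i : (2 ^+ 8 * p%:R)^-1 <= threshold p i.
Proof.
rewrite /threshold invfM mulrC ler_wpM2r ?invr_ge0 ?exprn_ge0//.
by rewrite lerDr invr_ge0 exprn_ge0.
Qed.

Lemma sum_threshold_le : \sum_(i < p.+1) threshold p i <= 3 / 2 ^+ 8.
Proof.
rewrite -mulr_suml ler_wpM2r ?invr_ge0 ?exprn_ge0// big_split/=.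
rewrite sumr_const card_ord.
(* Levels 0 and 1 both contribute 2^-p; the repeated term completes the geometric sum to exactly
   1. *)
have -> : \sum_(i < p.+1) (2 ^+ (p - i.-1))^-1 = 1 :> R.
  rewrite big_ord_recl/= subn0.
  have H q : (2 ^+ q)^-1 + \sum_(i < q) (2 ^+ (q - i))^-1 = 1 :> R.
    elim: q => [|q IHq]; first by rewrite big_ord0 expr0 invr1 addr0.
    rewrite big_ord_recl/= subn0.
    under eq_bigr do rewrite /bump /= add1n subSS.
    rewrite addrA (_ : (2 ^+ q.+1)^-1 + (2 ^+ q.+1)^-1 = (2 ^+ q)^-1)//.
    by rewrite exprS; field; rewrite gt_eqF// exprn_gt0.
  exact: H.
have p1 : 1 <= p%:R :> R by rewrite ler1n.
have -> : p%:R^-1 *+ p.+1 = 1 + p%:R^-1 :> R.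
  by rewrite -[LHS]mulr_natr -natr1; field; rewrite gt_eqF// ltr0n.
have : p%:R^-1 <= 1 :> R by rewrite invf_le1; lra.
lra.
Qed.

Lemma bmeas_sample_mean k (t : {ffun 'I_k -> D}) : bmeas (sample_mean t).
Proof.
rewrite /sample_mean /tuple_mean; under eq_fun do rewrite mulrC.
by apply/bmeasZ/bmeas_sum => i; apply: bmeasZ.
Qed.

Hypothesis u_l2 : forall j, \int[mu]_x u j x ^+ 2 <= 1.
(** The sample is fixed here. This condition and the next one are all that is required of it, and
    they do not mention the weights [pr], over which the conclusion is uniform. *)
Hypothesis emp_u_l2 : forall j, emp_mean ts (fun x => u j x ^+ 2) <= 2.
Hypothesis lower_tail : forall (i : 'I_p.+1) (t : {ffun 'I_(level_size A p i) -> D}),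
  threshold p i / 4 <= \int[mu]_x level K i (sample_mean t x) ^+ 2 ->
  (\int[mu]_x level K i (sample_mean t x) ^+ 2) / 2
    <= emp_mean ts (fun x => level K i (sample_mean t x) ^+ 2).

Variable pr : D -> R.
Hypotheses (pr_ge0 : forall j, 0 <= pr j) (pr_sum1 : \sum_j pr j = 1).

Let f x := \sum_j pr j * (2 ^+ p * u j x).
Hypothesis f_l2 : 1 / 2 <= \int[mu]_x f x ^+ 2 <= 1.

Let f_bmeas : bmeas f.
Proof. by apply: bmeas_sum => j; do 2 apply: bmeasZ. Qed.

Let f_le x : `|f x| <= K * 2 ^+ p.
Proof.
apply: (weighted_mean_le pr_ge0 pr_sum1) => j.
by rewrite normrM ger0_norm ?exprn_ge0// mulrC ler_wpM2r ?exprn_ge0.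
Qed.

Let q x := \sum_j pr j * u j x ^+ 2.

Let q_bmeas : bmeas q.
Proof. by apply: bmeas_sum => j; apply/bmeasZ/bmeas_sqr. Qed.

Let q_l2 : \int[mu]_x q x <= 1.
Proof.
rewrite bmeas_Rintegral_sum => [|j]; last exact/bmeasZ/bmeas_sqr.
rewrite -pr_sum1; apply: ler_sum => j _.
rewrite bmeas_RintegralZ; last exact: bmeas_sqr.
by rewrite -[leRHS]mulr1 ler_wpM2l.
Qed.

Let emp_q : emp_mean ts q <= 2.
Proof.
rewrite emp_mean_sum -[leRHS]mulr1 -[X in _ <= _ * X]pr_sum1 mulr_sumr.
apply: ler_sum => j _.
by rewrite emp_meanZ mulrC ler_wpM2r.
Qed.

Let err i (t : {ffun 'I_(level_size A p i) -> D}) x :=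
  (level K i (sample_mean t x) - level K i (f x)) ^+ 2.

Let err_bmeas i t : bmeas (@err i t).
Proof.
apply/bmeas_sqr/bmeasB; apply: bmeas_level => //.
exact: bmeas_sample_mean.
Qed.

(** One tuple has to be good for [mu] and for the sample simultaneously, so the averaging argument
    is applied to the sum of the two errors. The assumption on the empirical norm of f controls the
    f^2 part of the pointwise error bound. *)
Lemma exists_good_sample_mean i : (i <= p)%N -> emp_mean ts (fun x => f x ^+ 2) <= 1 ->
  exists t, \int[mu]_x @err i t x <= threshold p i / 2 ^+ 5 /\
            emp_mean ts (@err i t) <= threshold p i / 2 ^+ 5.
Proof.
move=> ip emp_f; have p0 : 0 < p%:R :> R by rewrite ltr0n.
have [t tle] : exists t : {ffun 'I_(level_size A p i) -> D},
    \int[mu]_x @err i t x + emp_mean ts (@err i t) <= (2 ^+ 13 * p%:R)^-1.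
  apply: (exists_le_tuple_mean pr_ge0 pr_sum1).
  pose g x := (f x ^+ 2 / 2 ^+ 15 + q x / 2 ^+ 17) / p%:R.
  have gE : g = fun x => (2 ^+ 15 * p%:R)^-1 * f x ^+ 2 + (2 ^+ 17 * p%:R)^-1 * q x.
    by apply/funext => x; rewrite /g; field; rewrite gt_eqF.
  have bf2 := bmeas_sqr f_bmeas.
  have bg : bmeas g by rewrite gE; apply: bmeasD; exact: bmeasZ.
  have le_g x : \sum_t tuple_weight pr t * @err i t x <= g x.
    exact: (level_mean_error pr_ge0 pr_sum1 K_gt0 (u_le^~ x) A_ge p_gt0 ip).
  have bsum : bmeas (fun x => \sum_t tuple_weight pr t * @err i t x).
    by apply: bmeas_sum => t; apply: bmeasZ.
  have -> : \sum_t tuple_weight pr t * (\int[mu]_x @err i t x + emp_mean ts (@err i t))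
    = \int[mu]_x (\sum_t tuple_weight pr t * @err i t x)
      + emp_mean ts (fun x => \sum_t tuple_weight pr t * @err i t x).
    rewrite bmeas_Rintegral_sum => [|t]; last exact: bmeasZ.
    rewrite emp_mean_sum -big_split/=; apply: eq_bigr => t _.
    by rewrite bmeas_RintegralZ// emp_meanZ mulrDr.
  apply: (@le_trans _ _ (\int[mu]_x g x + emp_mean ts g)).
    by rewrite lerD ?le_emp_mean ?bmeas_le_Rintegral.
  rewrite gE bmeas_RintegralD; [|exact: bmeasZ..].
  rewrite !bmeas_RintegralZ// emp_meanD !emp_meanZ.
  have i15 : (2 ^+ 15 * p%:R)^-1 = (2 ^+ 13 * p%:R)^-1 / 4 :> R.
    by field; rewrite gt_eqF.
  have i17 : (2 ^+ 17 * p%:R)^-1 = (2 ^+ 13 * p%:R)^-1 / 16 :> R.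
    by field; rewrite gt_eqF.
  rewrite i15 i17; have : 0 <= (2 ^+ 13 * p%:R)^-1 :> R.
    by rewrite invr_ge0 mulr_ge0 ?exprn_ge0.
  move: (2 ^+ 13 * p%:R)^-1 => c c0; case/andP: f_l2 => _ f1.
  have := ler_wpM2l c0 f1; have := ler_wpM2l c0 q_l2.
  by have := ler_wpM2l c0 emp_f; have := ler_wpM2l c0 emp_q; lra.
have ge : (2 ^+ 13 * p%:R)^-1 <= threshold p i / 2 ^+ 5.
  have -> : (2 ^+ 13 * p%:R)^-1 = (2 ^+ 8 * p%:R)^-1 / 2 ^+ 5 :> R.
    by field; rewrite gt_eqF.
  by rewrite ler_wpM2r ?invr_ge0 ?exprn_ge0// threshold_ge.
exists t; have e0 : 0 <= emp_mean ts (@err i t) by apply: emp_mean_ge0 => x; exact: sqr_ge0.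
have i0 : 0 <= \int[mu]_x @err i t x by apply: Rintegral_ge0 => x _; exact: sqr_ge0.
by split; lra.
Qed.

(** Passing from f to the sample mean and back costs a factor 2 and twice the error each time. The
    cut-off [threshold / 4] in [lower_tail] allows for this: a level of f heavier than [threshold]
    keeps at least that mass after the passage. *)
Lemma emp_mean_level_ge i : (i <= p)%N -> emp_mean ts (fun x => f x ^+ 2) <= 1 ->
  (\int[mu]_x level K i (f x) ^+ 2 - threshold p i) / 32
    <= emp_mean ts (fun x => level K i (f x) ^+ 2).
Proof.
move=> ip emp_f.
have [small|large] := leP (\int[mu]_x level K i (f x) ^+ 2) (threshold p i).
  have := @emp_mean_ge0 _ _ _ ts (fun x => level K i (f x) ^+ 2)
    (fun x => sqr_ge0 _); lra.
have [t [err_mu err_emp]] := exists_good_sample_mean ip emp_f.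
have bg := bmeas_sample_mean t.
have blg := bmeas_sqr (bmeas_level i K_gt0 bg).
have blf := bmeas_sqr (bmeas_level i K_gt0 f_bmeas).
have w0 : 0 <= threshold p i.
  by apply: le_trans (threshold_ge i); rewrite invr_ge0 mulr_ge0 ?exprn_ge0.
have w5 : threshold p i / 2 ^+ 5 = threshold p i / 32 by congr (_ / _); ring.
have mu_le : \int[mu]_x level K i (f x) ^+ 2
    <= 2 * (\int[mu]_x level K i (sample_mean t x) ^+ 2) + 2 * \int[mu]_x @err i t x.
  rewrite -!bmeas_RintegralZ// -bmeas_RintegralD; [|exact: bmeasZ..].
  apply: bmeas_le_Rintegral => //; first by apply: bmeasD; exact: bmeasZ.
  move=> x; rewrite /err.
  by have := sqr_ge0 (2 * level K i (sample_mean t x) - level K i (f x)); nra.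
have emp_le : emp_mean ts (fun x => level K i (sample_mean t x) ^+ 2)
    <= 2 * emp_mean ts (fun x => level K i (f x) ^+ 2) + 2 * emp_mean ts (@err i t).
  rewrite -!emp_meanZ -emp_meanD; apply: le_emp_mean => x; rewrite /err.
  by have := sqr_ge0 (2 * level K i (f x) - level K i (sample_mean t x)); nra.
have ip' : (i < p.+1)%N by [].
have := @lower_tail (Ordinal ip') t; rewrite /=; lra.
Qed.

Lemma emp_mean_sqr_ge : (2 ^+ 11)^-1 <= emp_mean ts (fun x => f x ^+ 2).
Proof.
(* An empirical norm above 1 is already sufficient; otherwise its bound by 1 feeds the Maurey
   error. *)
have [emp_f|emp_f] := leP (emp_mean ts (fun x => f x ^+ 2)) 1; last first.
  by apply: le_trans (ltW emp_f); rewrite invf_le1 ?exprn_gt0// exprn_ege1// ler1n.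
have bl i := bmeas_sqr (bmeas_level i K_gt0 f_bmeas).
have emp_ge : \sum_(i < p.+1) emp_mean ts (fun x => level K i (f x) ^+ 2)
    <= emp_mean ts (fun x => f x ^+ 2).
  by rewrite -emp_mean_sum; apply: le_emp_mean => x; exact: sum_sqr_level_le.
have mu_le : \int[mu]_x f x ^+ 2 <= 16 * \sum_(i < p.+1) \int[mu]_x level K i (f x) ^+ 2.
  rewrite -bmeas_Rintegral_sum => [|i]; last exact: bl.
  rewrite -bmeas_RintegralZ; last by apply: bmeas_sum => i; exact: bl.
  apply: bmeas_le_Rintegral; first exact: bmeas_sqr.
    by apply/bmeasZ/bmeas_sum => i; exact: bl.
  by move=> x; exact: sqr_le_sum_sqr_level.
have : \sum_(i < p.+1) ((\int[mu]_x level K i (f x) ^+ 2 - threshold p i) / 32)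
    <= \sum_(i < p.+1) emp_mean ts (fun x => level K i (f x) ^+ 2).
  by apply: ler_sum => i _; apply: emp_mean_level_ge => //; rewrite -ltnS.
(* Numerically, ((1/2)/16 - 3/256) / 32 = 5/2^13, which is above 2^-11 = 4/2^13. *)
rewrite -mulr_suml big_split/= sumrN.
have := sum_threshold_le; case/andP: f_l2 => f0 _.
have -> : 3 / 2 ^+ 8 = 3 / 256 :> R by congr (_ / _); ring.
have -> : (2 ^+ 11)^-1 = 8^-1 / 256 :> R by field.
lra.
Qed.

End RestrictedLowerBound.

(** * Chernoff bounds for i.i.d. samples *)

Section Chernoff.
Context d (T : measurableType d) (R : realType) (mu : probability T R).
Context d' (W : measurableType d') (Pr : probability W R).
Context (m : nat) (t : 'I_m -> {RV Pr >-> T}).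
Hypothesis iid_t : iid mu t.
Implicit Types (Y phi : T -> R) (S : set W).

Definition prob S : R := fine (Pr S).

Lemma prob_indic S : measurable S -> \int[Pr]_w \1_S w = prob S.
Proof. by move=> mS; rewrite /Rintegral integral_indic// setIT. Qed.

Lemma bmeas_indic d0 (T0 : measurableType d0) (S : set T0) :
  measurable S -> bmeas (\1_S : T0 -> R).
Proof.
move=> mS; split; first exact: measurable_indic.
by exists 1 => x; rewrite indicE; case: (_ \in _); rewrite ?normr1 ?normr0.
Qed.

Lemma bmeas_comp_RV l Y : bmeas Y -> bmeas (fun w => Y (t l w)).
Proof.
move=> [mY [M YM]]; split; last by exists M.
exact: (measurableT_comp mY (@measurable_funPT _ _ _ _ (t l))).
Qed.

Lemma bmeas_prod d0 (T0 : measurableType d0) (I : finType) (F : I -> T0 -> R) :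
  (forall i, bmeas (F i)) -> bmeas (fun x => \prod_i F i x).
Proof.
move=> bF; elim: (index_enum I) => [|i s IHs].
  by under eq_fun do rewrite big_nil; exact: bmeas_cst.
by under eq_fun do rewrite big_cons; exact: bmeasM.
Qed.

Lemma measurable_superlevel d0 (T0 : measurableType d0) (f : T0 -> R) (a : R) :
  bmeas f -> measurable [set x | a <= f x].
Proof.
move=> [mf _].
have -> : [set x | a <= f x] = setT `&` f @^-1` `[a, +oo[.
  by rewrite setTI; apply/seteqP; split => x /=; rewrite in_itv/= andbT.
exact: mf.
Qed.

Lemma measurable_sublevel_strict d0 (T0 : measurableType d0) (f : T0 -> R) (a : R) :
  bmeas f -> measurable [set x | f x < a].
Proof.
move=> bf; rewrite (_ : [set _ | _] = ~` [set x | a <= f x]).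
  exact/measurableC/measurable_superlevel.
by apply/seteqP; split => x /=; rewrite ltNge => /negP.
Qed.

Lemma le_prob S S' : measurable S -> measurable S' -> S `<=` S' -> prob S <= prob S'.
Proof.
move=> mS mS' SS'; rewrite fine_le ?fin_num_measure//.
by rewrite le_measure ?inE.
Qed.

Lemma bmeas_emp_mean phi : bmeas phi -> bmeas (fun w => emp_mean (fun l => t l w) phi).
Proof.
move=> bphi; rewrite /emp_mean; under eq_fun do rewrite mulrC.
by apply/bmeasZ/bmeas_sum => l; exact: bmeas_comp_RV.
Qed.

Lemma prob_rectangle (A : 'I_m -> set T) : (forall l, measurable (A l)) ->
  prob [set w | forall l, A l (t l w)] = \prod_(l < m) fine (mu (A l)).
Proof.
move=> mA; have [dist indep] := iid_t.
have -> : [set w | forall l, A l (t l w)] = [set w | forall l, l \in [set: 'I_m]%SET -> A l (t l w)].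
  by apply/seteqP; split => w /= H l; [move=> _; exact: H|apply: H; rewrite inE].
rewrite /prob indep//.
under eq_bigr => l _ do rewrite -[Pr _]/(distribution Pr (t l) (A l)) dist//.
have fmu l : mu (A l) = (fine (mu (A l)))%:E by rewrite fineK// fin_num_measure.
under eq_bigr => l _ do rewrite fmu.
rewrite prodEFin/=; by apply: eq_bigl => l; rewrite inE.
Qed.

(** [iid] concerns events only. For functions with finitely many values, expanding the product turns
    the integrand into a combination of indicators of rectangles, where independence applies
    directly. *)
Lemma integral_prod_finite (n : nat) (c : 'I_n -> R) (A : 'I_n -> set T) :
  (forall i, measurable (A i)) ->
  \int[Pr]_w (\prod_(l < m) \sum_(i < n) c i * \1_(A i) (t l w))
    = (\int[mu]_x (\sum_(i < n) c i * \1_(A i) x)) ^+ m.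
Proof.
move=> mA; pose S (s : {ffun 'I_m -> 'I_n}) := [set w | forall l, A (s l) (t l w)].
have SE s : S s = \big[setI/setT]_(l < m) (t l @^-1` A (s l)).
  apply/seteqP; split => w; rewrite -bigcap_seq /=; first by move=> H l _; exact: H.
  by move=> H l; apply: H; rewrite /= mem_index_enum.
have mS s : measurable (S s).
  rewrite SE; apply: bigsetI_measurable => l _.
  by rewrite -[X in measurable X]setTI; exact: measurable_funPT.
have -> : (fun w => \prod_(l < m) \sum_(i < n) c i * \1_(A i) (t l w))
    = fun w => \sum_(s : {ffun 'I_m -> 'I_n}) (\prod_l c (s l)) * \1_(S s) w.
  apply/funext => w; rewrite bigA_distr_bigA; apply: eq_bigr => s _.
  rewrite big_split/=; congr (_ * _).
  have [Sw|nSw] := pselect (S s w).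
    rewrite indicE mem_set// big1// => l _.
    by rewrite indicE mem_set//; exact: Sw.
  rewrite [RHS]indicE memNset//=.
  have [l nl] : exists l, ~ A (s l) (t l w) by apply/existsNP.
  by rewrite (bigD1 l)//= indicE memNset// mul0r.
rewrite bmeas_Rintegral_sum => [|s]; last by apply/bmeasZ/bmeas_indic.
rewrite bmeas_Rintegral_sum => [|i]; last by apply/bmeasZ/bmeas_indic.
transitivity (\prod_(l < m) \sum_(i < n) \int[mu]_x (c i * \1_(A i) x)); last first.
  by rewrite prodr_const card_ord.
rewrite bigA_distr_bigA; apply: eq_bigr => s _.
rewrite bmeas_RintegralZ; last exact: bmeas_indic.
rewrite prob_indic// /S (prob_rectangle (A := fun l => A (s l)))//.
rewrite -big_split/=; apply: eq_bigr => l _.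
rewrite bmeas_RintegralZ; last exact: bmeas_indic.
by rewrite /Rintegral integral_indic// setIT.
Qed.

Lemma bmeas_expR d0 (T0 : measurableType d0) (Y : T0 -> R) :
  bmeas Y -> bmeas (fun x => expR (Y x)).
Proof.
move=> [mY [M YM]]; split; first exact: (measurableT_comp (@measurable_expR R) mY).
exists (expR M) => x; rewrite ger0_norm ?expR_ge0// ler_expR.
by apply: le_trans (YM x); exact: ler_norm.
Qed.

(* Rounding Y up to a multiple of [del] reduces the claim to rectangles. *)
Lemma integral_exp_sum_le_slack Y (e : R) : bmeas Y -> 0 < e ->
  \int[Pr]_w expR (\sum_(l < m) Y (t l w))
    <= expR e * (\int[mu]_x expR (Y x)) ^+ m.
Proof.
move=> bY e0; have [mY [M YM]] := bY.
have m0 : 0 < m.+1%:R :> R by rewrite ltr0n.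
pose del := e / m.+1%:R; have del0 : 0 < del by rewrite divr_gt0.
have mdel : m%:R * del <= e.
  by rewrite /del mulrCA ler_piMr// ?(ltW e0)// ler_pdivrMr// mul1r ler_nat.
(* Cells of width [del] covering [-M, M]; the successor accounts for the right endpoint, as the
   cells are half open. *)
pose n := (Num.trunc (2 * M / del)).+1.
pose c (i : 'I_n) := expR (del * i.+1%:R - M).
pose A (i : 'I_n) := Y @^-1` `[del * i%:R - M, del * i.+1%:R - M[.
have mA i : measurable (A i) by rewrite -[A i]setTI; exact: mY.
pose G x := \sum_(i < n) c i * \1_(A i) x.
have bG : bmeas G by apply: bmeas_sum => i; apply/bmeasZ/bmeas_indic.
have Gbnd x : expR (Y x) <= G x <= expR del * expR (Y x).
  have := YM x; rewrite ler_norml => /andP[Y1 Y2].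
  have y0 : 0 <= (Y x + M) / del by rewrite divr_ge0// ?(ltW del0)//; lra.
  have /andP[t1 t2] := truncn_itv y0.
  have an : (Num.trunc ((Y x + M) / del) < n)%N.
    by rewrite ltnS le_truncn// ler_wpM2r ?invr_ge0 ?(ltW del0)//; lra.
  move: t1 t2; rewrite ler_pdivlMr// ltr_pdivrMr// => t1 t2.
  have Ai i : \1_(A i) x = (i == Ordinal an)%:R :> R.
    rewrite indicE; congr ((nat_of_bool _)%:R); apply/idP/eqP => [|->].
      rewrite inE /A /= in_itv/= => /andP[s1 s2].
      apply: val_inj => /=; apply/esym/truncn_def.
      by rewrite ler_pdivlMr// ltr_pdivrMr//; apply/andP; split; lra.
    by rewrite inE /A /= in_itv/=; apply/andP; split; lra.
  have -> : G x = c (Ordinal an).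
    rewrite /G (bigD1 (Ordinal an))//= Ai eqxx mulr1 big1 ?addr0// => i ni.
    by rewrite Ai (negbTE ni) mulr0.
  rewrite /c -expRD !ler_expR/=; apply/andP; split; first lra.
  by rewrite -natr1; lra.
have prodle w : expR (\sum_(l < m) Y (t l w)) <= \prod_(l < m) G (t l w).
  rewrite expR_sum; apply: ler_prod => l _; rewrite expR_ge0/=.
  by have /andP[] := Gbnd (t l w).
have bprod : bmeas (fun w => \prod_(l < m) G (t l w)).
  by apply: bmeas_prod => l; exact: bmeas_comp_RV.
apply: (@le_trans _ _ (\int[Pr]_w \prod_(l < m) G (t l w))).
  apply: bmeas_le_Rintegral => //; apply/bmeas_expR/bmeas_sum => l.
  exact: bmeas_comp_RV.
rewrite integral_prod_finite//.
have I0 : 0 <= \int[mu]_x expR (Y x) by apply: Rintegral_ge0 => x _; exact: expR_ge0.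
apply: (@le_trans _ _ ((expR del * \int[mu]_x expR (Y x)) ^+ m)).
  rewrite -bmeas_RintegralZ; last exact: bmeas_expR.
  apply: lerXn2r; rewrite ?nnegrE.
  - apply: Rintegral_ge0 => x _.
    by have /andP[+ _] := Gbnd x; apply: le_trans; exact: expR_ge0.
  - by apply: Rintegral_ge0 => x _; rewrite mulr_ge0 ?expR_ge0.
  - apply: bmeas_le_Rintegral => //; first exact/bmeasZ/bmeas_expR.
    by move=> x; have /andP[] := Gbnd x.
rewrite exprMn -expRM_natl; apply: ler_wpM2r; first exact: exprn_ge0.
by rewrite ler_expR.
Qed.

Lemma integral_exp_sum_le Y : bmeas Y ->
  \int[Pr]_w expR (\sum_(l < m) Y (t l w)) <= (\int[mu]_x expR (Y x)) ^+ m.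
Proof.
move=> bY; set X := \int[Pr]_w _; set Z := _ ^+ m.
have Z0 : 0 < Z.
  have [_ [M YM]] := bY; rewrite exprn_gt0//.
  apply: (@lt_le_trans _ _ (expR (- M))); first exact: expR_gt0.
  rewrite -[leLHS](Rintegral_prob_cst mu); apply: bmeas_le_Rintegral.
  - exact: bmeas_cst.
  - exact: bmeas_expR.
  - by move=> x; rewrite ler_expR; have := YM x; rewrite ler_norml => /andP[].
(* If X exceeded Z, the inequality with slack equal to half of the gap ln (X / Z) would be
   violated. *)
rewrite leNgt; apply/negP => ZX.
have r1 : 1 < X / Z by rewrite ltr_pdivlMr// mul1r.
have l0 : 0 < ln (X / Z) by rewrite ln_gt0.
have h0 : 0 < ln (X / Z) / 2 by rewrite divr_gt0.
have H : X <= expR (ln (X / Z) / 2) * Z := integral_exp_sum_le_slack bY h0.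
move: l0 H; rewrite -ler_pdivrMr// -[X in _ -> X <= _ -> _]lnK ?posrE ?ler_expR.
  by move=> ? ?; lra.
exact: lt_trans r1.
Qed.

Lemma chernoff_iid Y (a : R) : bmeas Y ->
  prob [set w | a <= \sum_(l < m) Y (t l w)]
    <= expR (- a) * (\int[mu]_x expR (Y x)) ^+ m.
Proof.
move=> bY.
have bS : bmeas (fun w => \sum_(l < m) Y (t l w)).
  by apply: bmeas_sum => l; exact: bmeas_comp_RV.
have mS : measurable [set w | a <= \sum_(l < m) Y (t l w)].
  exact: measurable_superlevel.
apply: (@le_trans _ _ (expR (- a) * \int[Pr]_w expR (\sum_(l < m) Y (t l w)))).
  rewrite -prob_indic// -bmeas_RintegralZ; last exact: bmeas_expR.
  apply: bmeas_le_Rintegral; first exact: bmeas_indic.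
    by apply/bmeasZ/bmeas_expR.
  move=> w; rewrite indicE -expRD; case: (boolP (w \in _)) => [|_]; last exact: expR_ge0.
  by rewrite inE /= => aw; rewrite -[leLHS]expR0 ler_expR addrC subr_ge0.
by rewrite ler_wpM2l ?expR_ge0// integral_exp_sum_le.
Qed.

(** Since phi^2 <= B phi, only the mean of phi enters. This yields Chernoff exponents linear in the
    mass of a level, where a bound through the range alone would be quadratic. *)
Lemma integral_exp_le phi (B lam : R) : bmeas phi ->
  (forall x, 0 <= phi x <= B) -> `|lam| * B <= 1 / 4 ->
  \int[mu]_x expR (lam * phi x)
    <= expR ((lam + lam ^+ 2 * B) * \int[mu]_x phi x).
Proof.
move=> bphi phiB lamB; apply: le_trans (expR_ge1Dx _).
rewrite -bmeas_RintegralZ// -[X in X + _](Rintegral_prob_cst mu).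
rewrite -bmeas_RintegralD; [|exact: bmeas_cst|exact: bmeasZ].
apply: bmeas_le_Rintegral; first exact/bmeas_expR/bmeasZ.
  by apply: bmeasD; [exact: bmeas_cst|exact: bmeasZ].
move=> x; have /andP[p0 pB] := phiB x.
apply: le_trans (expR_le_quadratic _) _.
  by rewrite normrM (ger0_norm p0); apply: le_trans lamB; rewrite ler_wpM2l.
rewrite mulrDl addrA lerD2l exprMn -mulrA ler_wpM2l ?sqr_ge0//.
by rewrite expr2 ler_wpM2r.
Qed.

Lemma prob_emp_mean_lt_half phi (B : R) : (0 < m)%N -> bmeas phi -> 0 < B ->
  (forall x, 0 <= phi x <= B) ->
  prob [set w | emp_mean (fun l => t l w) phi < (\int[mu]_x phi x) / 2]
    <= expR (- (m%:R * (\int[mu]_x phi x) / (16 * B))).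
Proof.
move=> m0 bphi B0 phiB; set th := \int[mu]_x phi x.
have mR0 : 0 < m%:R :> R by rewrite ltr0n.
(* The extreme admissible value; the exponent becomes 1/8 - 1/4 + 1/16 = -1/16 times m th / B. *)
pose lam := - (4 * B)^-1.
have lamB : `|lam| * B <= 1 / 4.
  rewrite normrN gtr0_norm ?invr_gt0 ?mulr_gt0// invfM -mulrA mulVf ?gt_eqF//.
  by rewrite mulr1; lra.
pose a := lam * (m%:R * th / 2).
apply: (@le_trans _ _ (prob [set w | a <= \sum_(l < m) lam * phi (t l w)])).
  apply: le_prob.
  - exact/measurable_sublevel_strict/bmeas_emp_mean.
  - apply/measurable_superlevel/bmeas_sum => l.
    by apply: bmeasZ; exact: bmeas_comp_RV.
  - move=> w /=; rewrite /emp_mean ltr_pdivrMr// => H.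
    rewrite -mulr_sumr /a ler_wnM2l ?oppr_le0 ?invr_ge0 ?mulr_ge0 ?(ltW B0)//.
    by apply: le_trans (ltW H) _; lra.
apply: le_trans (chernoff_iid a (bmeasZ lam bphi)) _.
have I0 : 0 <= \int[mu]_x expR (lam * phi x).
  by apply: Rintegral_ge0 => x _; exact: expR_ge0.
apply: (@le_trans _ _ (expR (- a) * expR ((lam + lam ^+ 2 * B) * th) ^+ m)).
  rewrite ler_wpM2l ?expR_ge0//; apply: lerXn2r; rewrite ?nnegrE ?expR_ge0//.
  exact: integral_exp_le.
rewrite -expRM_natl -expRD ler_expR le_eqVlt; apply/orP; left; apply/eqP.
by rewrite /a /lam; field; rewrite gt_eqF.
Qed.

Lemma prob_emp_mean_gt_two phi (B : R) : (0 < m)%N -> bmeas phi -> 0 < B ->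
  (forall x, 0 <= phi x <= B) -> \int[mu]_x phi x <= 1 ->
  prob [set w | 2 <= emp_mean (fun l => t l w) phi]
    <= expR (- (m%:R / (16 * B))).
Proof.
move=> m0 bphi B0 phiB; set th := \int[mu]_x phi x => th1.
have mR0 : 0 < m%:R :> R by rewrite ltr0n.
pose lam := (4 * B)^-1; have lam0 : 0 < lam by rewrite invr_gt0 mulr_gt0.
have lamB : `|lam| * B <= 1 / 4.
  rewrite gtr0_norm// /lam invfM -mulrA mulVf ?gt_eqF//.
  by rewrite mulr1; lra.
pose a := lam * (m%:R * 2).
apply: (@le_trans _ _ (prob [set w | a <= \sum_(l < m) lam * phi (t l w)])).
  apply: le_prob.
  - exact/measurable_superlevel/bmeas_emp_mean.
  - apply/measurable_superlevel/bmeas_sum => l.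
    by apply: bmeasZ; exact: bmeas_comp_RV.
  - move=> w /=; rewrite /emp_mean ler_pdivlMr// => H.
    by rewrite -mulr_sumr /a ler_wpM2l ?(ltW lam0)// mulrC.
apply: le_trans (chernoff_iid a (bmeasZ lam bphi)) _.
have I0 : 0 <= \int[mu]_x expR (lam * phi x).
  by apply: Rintegral_ge0 => x _; exact: expR_ge0.
apply: (@le_trans _ _ (expR (- a) * expR (lam + lam ^+ 2 * B) ^+ m)).
  rewrite ler_wpM2l ?expR_ge0//; apply: lerXn2r; rewrite ?nnegrE ?expR_ge0//.
  apply: le_trans (integral_exp_le bphi phiB lamB) _.
  rewrite ler_expR -[leRHS]mulr1 ler_wpM2l//.
  by rewrite addr_ge0 ?(ltW lam0)// mulr_ge0 ?sqr_ge0 ?ltW.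
rewrite -expRM_natl -expRD ler_expR.
have -> : - a + m%:R * (lam + lam ^+ 2 * B) = - (3 * (m%:R / (16 * B))).
  by rewrite /a /lam; field; rewrite gt_eqF.
have : 0 <= m%:R / (16 * B) by rewrite divr_ge0 ?mulr_ge0 ?(ltW B0).
lra.
Qed.

End Chernoff.

(** * The good event *)

Section UnionBound.
Context d (T : measurableType d) (R : realType) (mu : probability T R).
Context d' (W : measurableType d') (Pr : probability W R).
Context (m : nat) (t : 'I_m -> {RV Pr >-> T}).
Hypothesis iid_t : iid mu t.

Lemma measurable_bigsetU_fin (I : finType) (B : I -> set W) :
  (forall i, measurable (B i)) -> measurable (\big[setU/set0]_i B i).
Proof. by move=> mB; apply: bigsetU_measurable. Qed.

Lemma prob_bigsetU_le (I : finType) (B : I -> set W) (e : R) :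
  (forall i, measurable (B i)) -> (forall i, prob Pr (B i) <= e) ->
  prob Pr (\big[setU/set0]_i B i) <= #|I|%:R * e.
Proof.
move=> mB Be; have mU := measurable_bigsetU_fin mB.
rewrite -prob_indic//.
apply: (@le_trans _ _ (\int[Pr]_w \sum_i \1_(B i) w)).
  apply: bmeas_le_Rintegral; first exact: bmeas_indic.
    by apply: bmeas_sum => i; exact: bmeas_indic.
  move=> w; rewrite indicE; case: (boolP (w \in _)) => [|_]; last exact: sumr_ge0.
  rewrite inE -bigcup_seq => -[i _ Biw].
  rewrite (bigD1 i)//= [in leRHS]indicE mem_set// lerDl.
  exact: sumr_ge0.
rewrite bmeas_Rintegral_sum => [|i]; last exact: bmeas_indic.
rewrite mulr_natl -sumr_const; apply: ler_sum => i _.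
by rewrite prob_indic.
Qed.

Lemma prob_setU_le (A B : set W) : measurable A -> measurable B ->
  prob Pr (A `|` B) <= prob Pr A + prob Pr B.
Proof.
move=> mA mB; have mU := measurableU _ _ mA mB.
rewrite -!prob_indic// -bmeas_RintegralD; [|exact: bmeas_indic..].
apply: bmeas_le_Rintegral; first exact: bmeas_indic.
  by apply: bmeasD; exact: bmeas_indic.
move=> w; rewrite !indicE in_setU.
by case: (w \in A); case: (w \in B); rewrite /= ?(addr0, add0r) ?lerDl.
Qed.

Lemma prob_setC (A : set W) : measurable A -> prob Pr (~` A) = 1 - prob Pr A.
Proof.
move=> mA; rewrite /prob probability_setC// fineB ?fin_num_measure//.
Qed.

Variables (D : finType) (K : R) (u : D -> T -> R) (A p : nat) (Y : R).
Hypotheses (K_gt0 : 0 < K) (u_le : forall j x, `|u j x| <= K).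
Hypotheses (u_bmeas : forall j, bmeas (u j)).
Hypothesis u_l2 : forall j, \int[mu]_x u j x ^+ 2 <= 1.
Hypotheses (p_gt0 : (0 < p)%N) (D_ge : 1 <= ln #|D|%:R :> R) (Y_ge0 : 0 <= Y).
(** The constant 2^14 is 16 * 4 * 2^8: from the Chernoff exponent, from the cut-off [threshold / 4],
    and from the definition of [threshold]. *)
Hypothesis m_ge : 2 ^+ 14 * (A%:R + 2) * K ^+ 2 * 4 ^+ p *
  (p%:R ^+ 2 * ln #|D|%:R + Y) <= m%:R.

Let p_ge1 : 1 <= p%:R :> R. Proof. by rewrite ler1n. Qed.

Let card_gt0 : 0 < #|D|%:R :> R.
Proof.
rewrite ltNge; apply/negP => /ln0 l0.
by move: D_ge; rewrite l0 ler10.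
Qed.

Let H_ge1 : 1 <= p%:R ^+ 2 * ln #|D|%:R + Y.
Proof.
have : 1 <= p%:R ^+ 2 * ln #|D|%:R :> R by rewrite mulr_ege1// exprn_ege1.
by have := Y_ge0; lra.
Qed.

Let m_gt0 : (0 < m)%N.
Proof.
rewrite -(ltr0n R); apply: lt_le_trans m_ge.
have a0 : 0 <= A%:R :> R by [].
have Y0 := Y_ge0; have p1 := p_ge1; have H1 := H_ge1.
by rewrite !mulr_gt0 ?exprn_gt0//; lra.
Qed.

Let diag_exponent : ln #|D|%:R + (Y + p%:R + 1) <= m%:R / (16 * K ^+ 2).
Proof.
rewrite ler_pdivlMr ?mulr_gt0 ?exprn_gt0//; apply: le_trans m_ge.
have a0 : 0 <= A%:R :> R by [].
have Y0 := Y_ge0; have p1 := p_ge1; have H1 := H_ge1.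
have K2 : 0 < K ^+ 2 by rewrite exprn_gt0.
have p4 : 1 <= 4 ^+ p :> R by rewrite exprn_ege1// ler1n.
set l := ln _; have l1 : 1 <= l := D_ge.
have pp : p%:R * 1 <= p%:R ^+ 2 * l.
  by apply: ler_pM => //; rewrite expr2 ler_peMl//; lra.
have ll : l * 1 <= l * p%:R ^+ 2 by rewrite ler_wpM2l ?exprn_ege1//; lra.
set H := p%:R ^+ 2 * l + Y.
have h4 : l + (Y + p%:R + 1) <= 4 * H by rewrite /H; lra.
apply: (@le_trans _ _ (4 * H * (16 * K ^+ 2))).
  by rewrite ler_wpM2r// mulr_ge0// ltW.
have -> : 2 ^+ 14 * (A%:R + 2) * K ^+ 2 * 4 ^+ p * H
   = (16 * 4 * K ^+ 2 * H) * (2 ^+ 8 * (A%:R + 2) * 4 ^+ p) by ring.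
rewrite (_ : 4 * H * _ = 16 * 4 * K ^+ 2 * H); last by ring.
have H0 : 0 <= H by rewrite /H; lra.
rewrite -[leLHS]mulr1; apply: ler_wpM2l; first by do ?apply: mulr_ge0 => //; exact: ltW.
have e8 : 1 <= 2 ^+ 8 :> R by rewrite exprn_ege1// ler1n.
have A2 : 1 <= A%:R + 2 :> R by lra.
by rewrite mulr_ege1// mulr_ege1.
Qed.

Let level_exponent i : (i <= p)%N ->
  (level_size A p i)%:R * ln #|D|%:R + (Y + p%:R + 1)
    <= m%:R * (threshold R p i / 4) / (16 * height K i ^+ 2).
Proof.
move=> ip; have a0 : 0 <= A%:R :> R by [].
have Y0 := Y_ge0; have p1 := p_ge1; have H1 := H_ge1.
have K2 : 0 < K ^+ 2 by rewrite exprn_gt0.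
set l := ln _; have l1 : 1 <= l := D_ge.
have jp : (i.-1 <= p)%N by case: i ip => //= i; exact: ltnW.
set j := i.-1 in jp *.
set s : R := 2 ^+ (p - j).
have s1 : 1 <= s by rewrite /s exprn_ege1// ler1n.
set r : R := 2 ^+ j; have r0 : 0 < r by rewrite exprn_gt0.
have pE : 4 ^+ p = (r * s) * (r * s) :> R.
  have -> : r * s = 2 ^+ p by rewrite /r /s -exprD subnKC.
  exact: expr4n.
have kE : (level_size A p i)%:R = A%:R * p%:R * (s * s) :> R.
  by rewrite /level_size natrM natrM natrX expr4n.
rewrite kE /height -/j -/r /threshold -/j -/s.
have p0 : 0 < p%:R :> R by lra.
have s0 : 0 < s by lra.
have thr0 : 0 <= (s^-1 + p%:R^-1) / 2 ^+ 8 / 4 :> R.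
  by rewrite !divr_ge0 ?exprn_ge0// addr_ge0 ?invr_ge0 ?ltW.
apply: (@le_trans _ _ ((A%:R + 2) * (s * s) * (p%:R ^+ 2 * l + Y) * (s^-1 + p%:R^-1))).
  (* The A copies of p l s^2 are the entropy, the 2 spare ones are at least p + 1, and Y s is at
     least Y; the remaining products are nonnegative and discarded. *)
  have -> : (A%:R + 2) * (s * s) * (p%:R ^+ 2 * l + Y) * (s^-1 + p%:R^-1)
    = (A%:R + 2) * (p%:R * l * (s * s) + Y * s)
      + (A%:R + 2) * (p%:R ^+ 2 * l * s + Y * (s * s) / p%:R).
    by field; rewrite !gt_eqF.
  have ps : p%:R <= p%:R * l * (s * s).
    rewrite -mulrA -[leLHS]mulr1; apply: ler_wpM2l; first exact: ltW.
    by rewrite mulr_ege1// mulr_ege1.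
  have Ys : Y <= Y * s by rewrite ler_peMr.
  have z1 : 0 <= (A%:R + 2) * (p%:R ^+ 2 * l * s + Y * (s * s) / p%:R).
    rewrite mulr_ge0 ?addr_ge0// ?divr_ge0 ?mulr_ge0 ?exprn_ge0 ?(ltW s0)//; lra.
  have z2 : 0 <= A%:R * (Y * s) by rewrite mulr_ge0// mulr_ge0// ltW.
  by lra.
apply: (@le_trans _ _ ((2 ^+ 14 * (A%:R + 2) * K ^+ 2 * 4 ^+ p *
  (p%:R ^+ 2 * l + Y)) * ((s^-1 + p%:R^-1) / 2 ^+ 8 / 4) / (16 * (K * r) ^+ 2))).
  rewrite pE le_eqVlt; apply/orP; left; apply/eqP.
  by field; rewrite !gt_eqF.
apply: ler_wpM2r; first by rewrite invr_ge0 mulr_ge0// sqr_ge0.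
exact: ler_wpM2r.
Qed.

Let size_bound k (e : R) : k%:R * ln #|D|%:R + (Y + p%:R + 1) <= e ->
  #|D|%:R ^+ k * expR (- e) <= expR (- (Y + p%:R + 1)).
Proof.
move=> le_e; rewrite -[#|D|%:R]lnK ?posrE// -expRM_natl -expRD ler_expR.
by lra.
Qed.

Let bad_diag j := [set w | 2 <= emp_mean (fun l => t l w) (fun x => u j x ^+ 2)].

Let g i (s : {ffun 'I_(level_size A p i) -> D}) x :=
  level K i (sample_mean u p s x) ^+ 2.

Let bad_level i (s : {ffun 'I_(level_size A p i) -> D}) : set W :=
  if threshold R p i / 4 <= \int[mu]_x @g i s x
  then [set w | emp_mean (fun l => t l w) (@g i s) < (\int[mu]_x @g i s x) / 2]
  else set0.

Let bad := \big[setU/set0]_j bad_diag j `|`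
  \big[setU/set0]_(i < p.+1) \big[setU/set0]_s @bad_level i s.

Let g_bmeas i s : bmeas (@g i s).
Proof. exact/bmeas_sqr/bmeas_level/bmeas_sample_mean. Qed.

Let measurable_bad_diag j : measurable (bad_diag j).
Proof. by apply/measurable_superlevel/bmeas_emp_mean/bmeas_sqr. Qed.

Let measurable_bad_level i s : measurable (@bad_level i s).
Proof.
rewrite /bad_level; case: ifP => // _.
by apply/measurable_sublevel_strict/bmeas_emp_mean.
Qed.

Let measurable_bad : measurable bad.
Proof.
apply: measurableU; first exact: measurable_bigsetU_fin.
by apply: measurable_bigsetU_fin => i; exact: measurable_bigsetU_fin.
Qed.

Let prob_bad_diag j : prob Pr (bad_diag j) <= expR (- (m%:R / (16 * K ^+ 2))).
Proof.
apply: (prob_emp_mean_gt_two iid_t m_gt0 (bmeas_sqr (u_bmeas j)) _ _ (u_l2 j)).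
  by rewrite exprn_gt0.
move=> x; rewrite sqr_ge0/= -(real_normK (num_real (u j x))).
by rewrite ler_pXn2r ?nnegrE// ltW.
Qed.

Let prob_bad_level i s : prob Pr (@bad_level i s)
  <= expR (- (m%:R * (threshold R p i / 4) / (16 * height K i ^+ 2))).
Proof.
have h0 := height_gt0 i K_gt0.
rewrite /bad_level; case: ifPn => [thr|_]; last by rewrite /prob measure0 expR_ge0.
apply: le_trans (@prob_emp_mean_lt_half _ _ _ _ _ _ _ _ _ iid_t _ (height K i ^+ 2)
  m_gt0 (@g_bmeas i s) _ _) _.
- by rewrite exprn_gt0.
- move=> x; rewrite sqr_ge0/=.
  have /andP[l0 lh] := level_bounds i (sample_mean u p s x) K_gt0.
  by rewrite ler_pXn2r ?nnegrE// ltW.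
rewrite ler_expR lerN2; apply: ler_wpM2r; first by rewrite invr_ge0 mulr_ge0// sqr_ge0.
exact: ler_wpM2l.
Qed.

Let prob_bad_le : prob Pr bad <= expR (- Y).
Proof.
apply: le_trans (prob_setU_le _ _) _.
- exact: measurable_bigsetU_fin.
- by apply: measurable_bigsetU_fin => i; exact: measurable_bigsetU_fin.
apply: (@le_trans _ _ (expR (- (Y + p%:R + 1)) + p.+1%:R * expR (- (Y + p%:R + 1)))).
  apply: lerD.
    apply: le_trans (prob_bigsetU_le measurable_bad_diag prob_bad_diag) _.
    by rewrite -[#|D|%:R]expr1; apply: size_bound; rewrite mul1r.
  rewrite -[p.+1 in leRHS]card_ord; apply: prob_bigsetU_le => i.
    exact: measurable_bigsetU_fin.
  apply: le_trans (prob_bigsetU_le (@measurable_bad_level i) (@prob_bad_level i)) _.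
  rewrite card_ffun card_ord natrX; apply: size_bound.
  by apply: level_exponent; rewrite -ltnS.
(* The diagonal events and the p + 1 levels give p + 2 equal terms, and p + 2 <= e^(p+1). *)
have -> : - (Y + p%:R + 1) = - Y + - p.+1%:R :> R by rewrite -natr1; ring.
rewrite expRD -[X in X + _]mul1r -mulrDl mulrCA ler_piMr ?expR_ge0//.
by rewrite expRN ler_pdivrMr ?expR_gt0// mul1r expR_ge1Dx.
Qed.

Lemma exists_good_event : exists G : set W, [/\ measurable G,
  1 - expR (- Y) <= prob Pr G &
  forall w, G w ->
    (forall j, emp_mean (fun l => t l w) (fun x => u j x ^+ 2) <= 2) /\
    (forall (i : 'I_p.+1) (s : {ffun 'I_(level_size A p i) -> D}),
      threshold R p i / 4 <= \int[mu]_x level K i (sample_mean u p s x) ^+ 2 ->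
      (\int[mu]_x level K i (sample_mean u p s x) ^+ 2) / 2 <=
      emp_mean (fun l => t l w) (fun x => level K i (sample_mean u p s x) ^+ 2))].
Proof.
exists (~` bad); split.
- exact: measurableC.
- by rewrite prob_setC// lerD2l lerN2.
move=> w nbad; split => [j|i s thr].
  rewrite leNgt; apply/negP => gt2; apply: nbad; left.
  rewrite -bigcup_seq; exists j; first by rewrite /= mem_index_enum.
  exact: ltW.
rewrite leNgt; apply/negP => lt; apply: nbad; right.
rewrite -bigcup_seq; exists i; first by rewrite /= mem_index_enum.
rewrite -bigcup_seq; exists s; first by rewrite /= mem_index_enum.
by rewrite /bad_level /g thr.
Qed.

End UnionBound.

(** * From convex combinations to real coefficient vectors *)

Section RealLowerBound.
Context d (T : measurableType d) (R : realType) (mu : probability T R).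
Context d' (W : measurableType d') (Pr : probability W R).
Context (m : nat) (t : 'I_m -> {RV Pr >-> T}).
Hypothesis iid_t : iid mu t.
Variables (E : finType) (K : R) (g : E -> T -> R) (p A : nat) (Y : R).
Hypotheses (K_gt0 : 0 < K) (g_le : forall e x, `|g e x| <= K).
Hypotheses (g_bmeas : forall e, bmeas (g e)).
Hypothesis g_l2 : forall e, \int[mu]_x g e x ^+ 2 <= 1.
Hypotheses (A_ge : 2 ^+ 21 <= A%:R :> R) (p_gt0 : (0 < p)%N).

(* [None] absorbs the weight missing from a convex combination. *)
Definition signed_dict (j : option (E * bool)) (x : T) : R :=
  if j is Some (e, s) then (-1) ^+ s * g e x else 0.

Lemma card_signed_dict : #|{: option (E * bool)}| = (2 * #|E|).+1.
Proof. by rewrite card_option card_prod card_bool mulnC. Qed.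

Hypotheses (D_ge : 1 <= ln #|{: option (E * bool)}|%:R :> R) (Y_ge0 : 0 <= Y).
Hypothesis m_ge : 2 ^+ 14 * (A%:R + 2) * K ^+ 2 * 4 ^+ p *
  (p%:R ^+ 2 * ln #|{: option (E * bool)}|%:R + Y) <= m%:R.

Let u_le j x : `|signed_dict j x| <= K.
Proof.
case: j => [[e s]|] /=; last by rewrite normr0 ltW.
by rewrite normrM normrX normrN1 expr1n mul1r.
Qed.

Let u_bmeas j : bmeas (signed_dict j).
Proof.
by case: j => [[e s]|]; [exact: bmeasZ|exact: bmeas_cst].
Qed.

Let u_l2 j : \int[mu]_x signed_dict j x ^+ 2 <= 1.
Proof.
case: j => [[e s]|] /=; last first.
  by under eq_Rintegral do rewrite expr0n/=; rewrite Rintegral_prob_cst.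
by under eq_Rintegral do rewrite exprMn -exprM mulnC exprM sqrrN expr1n expr1n mul1r.
Qed.

(** Positive and negative parts of [gam], divided by the l1 radius 2^p S: the two weights of e
    differ by gam e / (2^p S) and add up to |gam e| / (2^p S). *)
Let weight (gam : E -> R) (S : R) (j : option (E * bool)) : R :=
  if j is Some (e, s) then (`|gam e| + (-1) ^+ s * gam e) / (2 * (2 ^+ p * S))
  else 1 - (\sum_e `|gam e|) / (2 ^+ p * S).

Lemma big_option (I : finType) (F : option I -> R) :
  \sum_j F j = F None + \sum_i F (Some i).
Proof.
rewrite (bigD1 None)//=; congr (_ + _).
rewrite (reindex_omap Some id)/=; last by case.
by apply: eq_bigl => i; rewrite eqxx.
Qed.

Lemma big_prod_bool (I : finType) (F : I * bool -> R) :
  \sum_j F j = \sum_i (F (i, true) + F (i, false)).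
Proof.
rewrite (eq_bigr (fun j => F (j.1, j.2))) => [|[]//].
rewrite -(pair_bigA _ (fun i s => F (i, s)))/=.
by apply: eq_bigr => i _; rewrite big_bool.
Qed.

(** [S] is kept apart from the norm of the function: it will be the norm of a complex combination,
    of which the real or the imaginary part retains at least half of the square. *)
Lemma exists_real_lower_bound_event : exists G : set W, [/\ measurable G,
  1 - expR (- Y) <= prob Pr G &
  forall w, G w -> forall (gam : E -> R) (S : R),
    0 < S -> \sum_e `|gam e| <= 2 ^+ p * S ->
    S ^+ 2 / 2 <= \int[mu]_x (\sum_e gam e * g e x) ^+ 2 <= S ^+ 2 ->
    S ^+ 2 / 2 ^+ 11 <=
      emp_mean (fun l => t l w) (fun x => (\sum_e gam e * g e x) ^+ 2)].
Proof.
have [G [mG PG HG]] := exists_good_event iid_t K_gt0 u_le u_bmeas u_l2 p_gt0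
  D_ge Y_ge0 m_ge.
exists G; split => // w /HG[emp_u low] gam S S0 gam1 /andP[Slo Shi].
have L0 : 0 < 2 ^+ p * S by rewrite mulr_gt0// exprn_gt0.
have pr_ge0 j : 0 <= weight gam S j.
  case: j => [[e s]|] /=; last by rewrite subr_ge0 ler_pdivrMr// mul1r.
  rewrite divr_ge0 ?mulr_ge0 ?exprn_ge0 ?(ltW S0)//.
  case: s; rewrite ?expr1 ?expr0 ?mulN1r ?mul1r.
    by rewrite subr_ge0 ler_norm.
  by have := ler_norm (- gam e); rewrite normrN; lra.
have pr_sum1 : \sum_j weight gam S j = 1.
  rewrite big_option big_prod_bool /= mulr_suml -addrA; apply/eqP.
  rewrite -subr_eq0 addrAC subrr add0r addrC -sumrB big1// => e _.
  by rewrite expr1 expr0; field; rewrite !gt_eqF// exprn_gt0.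
have S2 : 0 < S ^+ 2 by rewrite exprn_gt0.
have fE x : \sum_j weight gam S j * (2 ^+ p * signed_dict j x)
    = S^-1 * \sum_e gam e * g e x.
  rewrite big_option big_prod_bool /= !mulr0 add0r mulr_sumr.
  apply: eq_bigr => e _.
  by rewrite expr1 expr0; field; rewrite !gt_eqF// exprn_gt0.
have bF : bmeas (fun x => \sum_e gam e * g e x).
  by apply: bmeas_sum => e; exact: bmeasZ.
have f_l2 : 1 / 2 <= \int[mu]_x (\sum_j weight gam S j * (2 ^+ p * signed_dict j x)) ^+ 2 <= 1.
  under eq_Rintegral do rewrite fE exprMn exprVn.
  rewrite bmeas_RintegralZ; last exact: bmeas_sqr.
  rewrite (mulrC (S ^+ 2)^-1) ler_pdivlMr// ler_pdivrMr//.
  by apply/andP; split; lra.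
have := emp_mean_sqr_ge K_gt0 u_le u_bmeas A_ge p_gt0 u_l2 emp_u low pr_ge0 pr_sum1 f_l2.
rewrite (_ : (fun x => _) = fun x => (S ^+ 2)^-1 * (\sum_e gam e * g e x) ^+ 2).
  by rewrite emp_meanZ [leRHS]mulrC ler_pdivlMr// mulrC.
by apply/funext => x; rewrite fE exprMn exprVn.
Qed.

End RealLowerBound.

(** * Bounded orthonormal systems *)

Section ComplexModulus.
Variable R : rcfType.
Implicit Types z w : R[i].

Lemma ReD z w : complex.Re (z + w) = complex.Re z + complex.Re w.
Proof. by case: z w => [a b] [c e]. Qed.

Lemma ImD z w : complex.Im (z + w) = complex.Im z + complex.Im w.
Proof. by case: z w => [a b] [c e]. Qed.

Lemma ReM z w :
  complex.Re (z * w) = complex.Re z * complex.Re w - complex.Im z * complex.Im w.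
Proof. by case: z w => [a b] [c e]. Qed.

Lemma ImM z w :
  complex.Im (z * w) = complex.Re z * complex.Im w + complex.Im z * complex.Re w.
Proof. by case: z w => [a b] [c e]. Qed.

Lemma Re_sum (I : Type) (s : seq I) (P : pred I) (F : I -> R[i]) :
  complex.Re (\sum_(i <- s | P i) F i) = \sum_(i <- s | P i) complex.Re (F i).
Proof. exact: (big_morph _ ReD). Qed.

Lemma Im_sum (I : Type) (s : seq I) (P : pred I) (F : I -> R[i]) :
  complex.Im (\sum_(i <- s | P i) F i) = \sum_(i <- s | P i) complex.Im (F i).
Proof. exact: (big_morph _ ImD). Qed.

Lemma ReJ z : complex.Re (z^*) = complex.Re z.
Proof. by case: z. Qed.

Lemma ImJ z : complex.Im (z^*) = - complex.Im z.
Proof. by case: z. Qed.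

Lemma complex_inj z w :
  complex.Re z = complex.Re w -> complex.Im z = complex.Im w -> z = w.
Proof. by case: z w => [a b] [c e] /= -> ->. Qed.

Lemma cmod_ge0 z : 0 <= cmod z.
Proof. by case: z => a b; exact: sqrtr_ge0. Qed.

Lemma sqr_cmod z : cmod z ^+ 2 = complex.Re z ^+ 2 + complex.Im z ^+ 2.
Proof. by case: z => a b /=; rewrite sqr_sqrtr// addr_ge0 ?sqr_ge0. Qed.

Lemma sqr_cmodE z : cmod z ^+ 2 = complex.Re (z * z^*).
Proof. by rewrite sqr_cmod ReM ReJ ImJ mulrN opprK !expr2. Qed.

Lemma Re_le_cmod z : `|complex.Re z| <= cmod z.
Proof.
rewrite -(@ler_pXn2r _ 2)// ?nnegrE ?cmod_ge0//.
by rewrite (real_normK (num_real _)) sqr_cmod lerDl sqr_ge0.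
Qed.

Lemma Im_le_cmod z : `|complex.Im z| <= cmod z.
Proof.
rewrite -(@ler_pXn2r _ 2)// ?nnegrE ?cmod_ge0//.
by rewrite (real_normK (num_real _)) sqr_cmod lerDr sqr_ge0.
Qed.

Lemma cmod_le_normD z : cmod z <= `|complex.Re z| + `|complex.Im z|.
Proof.
rewrite -(@ler_pXn2r _ 2)// ?nnegrE ?cmod_ge0 ?addr_ge0//.
rewrite sqr_cmod -(real_normK (num_real (complex.Re z))).
rewrite -(real_normK (num_real (complex.Im z))).
have := mulr_ge0 (normr_ge0 (complex.Re z)) (normr_ge0 (complex.Im z)); lra.
Qed.

Lemma cmodM z w : cmod (z * w) = cmod z * cmod w.
Proof. exact: ComplexField.Normc.normcM. Qed.

Lemma cmodD z w : cmod (z + w) <= cmod z + cmod w.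
Proof. exact: (@le_normcD R z w). Qed.

Lemma cmodN z : cmod (- z) = cmod z.
Proof. exact: (@normcN R z). Qed.

Lemma cmodB z w : cmod (z - w) <= cmod z + cmod w.
Proof. by rewrite -(cmodN w) cmodD. Qed.

Lemma cmod_eq0 z : cmod z = 0 -> z = 0.
Proof. exact: ComplexField.Normc.eq0_normc. Qed.

Lemma cmod0 : cmod (0 : R[i]) = 0.
Proof. exact: ComplexField.Normc.normc0. Qed.

Lemma cmod_sum (I : Type) (s : seq I) (P : pred I) (F : I -> R[i]) :
  cmod (\sum_(i <- s | P i) F i) <= \sum_(i <- s | P i) cmod (F i).
Proof.
elim/big_rec2: _ => [|i x y _ IH]; first by rewrite cmod0.
by apply: le_trans (cmodD _ _) _; rewrite lerD2l.
Qed.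

End ComplexModulus.

Section BoundedOrthonormalSystem.
Context d (T : measurableType d) (R : realType) (mu : probability T R).
Context (I : choiceType) (b : I -> T -> R[i]) (K : R).
Implicit Types f : T -> R[i].

Lemma linfnorm_leP f (M : R) : (linfnorm f <= M%:E)%E <-> forall x, cmod (f x) <= M.
Proof.
split=> [le_M x|H].
  by rewrite -lee_fin; apply: le_trans le_M; apply: ereal_sup_ubound; exists x.
by apply: ge_ereal_sup => _ [x _ <-]; rewrite lee_fin.
Qed.

Lemma linfnorm_ge0 f : (0 <= linfnorm f)%E.
Proof.
apply: (@le_trans _ _ (cmod (f point))%:E); first by rewrite lee_fin cmod_ge0.
by apply: ereal_sup_ubound; exists point.
Qed.

Lemma Linf_bounded f : Linf f -> exists M : R, forall x, cmod (f x) <= M.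
Proof.
move=> [_ fy]; exists (fine (linfnorm f)); apply/linfnorm_leP.
by rewrite fineK// ge0_fin_numE// linfnorm_ge0.
Qed.

Lemma Linf_bmeas_Re f : Linf f -> bmeas (fun x => complex.Re (f x)).
Proof.
move=> Lf; have [M fM] := Linf_bounded Lf; have [[mf _] _] := Lf.
by split => //; exists M => x; apply: le_trans (Re_le_cmod _) (fM x).
Qed.

Lemma Linf_bmeas_Im f : Linf f -> bmeas (fun x => complex.Im (f x)).
Proof.
move=> Lf; have [M fM] := Linf_bounded Lf; have [[_ mf] _] := Lf.
by split => //; exists M => x; apply: le_trans (Im_le_cmod _) (fM x).
Qed.

Lemma bmeas_sqr_cmod f : Linf f -> bmeas (fun x => cmod (f x) ^+ 2).
Proof.
move=> Lf; under eq_fun do rewrite sqr_cmod.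
by apply: bmeasD; apply: bmeas_sqr; [exact: Linf_bmeas_Re|exact: Linf_bmeas_Im].
Qed.

Lemma bmeas_Linf f : bmeas (fun x => complex.Re (f x)) ->
  bmeas (fun x => complex.Im (f x)) -> Linf f.
Proof.
move=> [mr [M rM]] [mi [N iN]]; split => //.
apply: (@le_lt_trans _ _ (M + N)%:E); last exact: ltry.
apply/linfnorm_leP => x; apply: le_trans (cmod_le_normD _) _.
exact: lerD.
Qed.

Hypothesis bos : bounded_orthonormal_system mu b K.

Lemma bos_Linf j : Linf (b j). Proof. by case: bos. Qed.

Lemma bos_le j x : cmod (b j x) <= K.
Proof. by case: bos => _ _ /(_ j) /linfnorm_leP. Qed.

Lemma bmeas_Re_bos j : bmeas (fun x => complex.Re (b j x)).
Proof. exact: Linf_bmeas_Re (bos_Linf j). Qed.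

Lemma bmeas_Im_bos j : bmeas (fun x => complex.Im (b j x)).
Proof. exact: Linf_bmeas_Im (bos_Linf j). Qed.

Lemma bmeas_Re_bosJ j k : bmeas (fun x => complex.Re (b j x * (b k x)^*)).
Proof.
under eq_fun do rewrite ReM ReJ ImJ mulrN opprK.
by apply: bmeasD; apply: bmeasM; (exact: bmeas_Re_bos || exact: bmeas_Im_bos).
Qed.

Lemma bmeas_Im_bosJ j k : bmeas (fun x => complex.Im (b j x * (b k x)^*)).
Proof.
under eq_fun do rewrite ImM ReJ ImJ mulrN.
by apply: bmeasD; [apply: bmeasN|]; apply: bmeasM;
  (exact: bmeas_Re_bos || exact: bmeas_Im_bos).
Qed.

Lemma Rintegral_Re_bosJ j k :
  \int[mu]_x complex.Re (b j x * (b k x)^*) = (j == k)%:R.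
Proof.
have [_ /(_ j k) H _] := bos; have := congr1 (@complex.Re R) H.
by rewrite /cintegral /= => ->; case: (j == k).
Qed.

Lemma Rintegral_Im_bosJ j k : \int[mu]_x complex.Im (b j x * (b k x)^*) = 0.
Proof.
have [_ /(_ j k) H _] := bos; have := congr1 (@complex.Im R) H.
by rewrite /cintegral /= => ->; case: (j == k).
Qed.

Lemma K_ge1 (j : I) : 1 <= K.
Proof.
have K0 : 0 <= K by apply: le_trans (cmod_ge0 _) (bos_le j point).
have : 1 <= K ^+ 2.
  have e1 : \int[mu]_x complex.Re (b j x * (b j x)^*) = 1.
    by rewrite Rintegral_Re_bosJ eqxx.
  rewrite -[leLHS]e1.
  rewrite -[leRHS](Rintegral_prob_cst mu); apply: bmeas_le_Rintegral.
  - exact: bmeas_Re_bosJ.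
  - exact: bmeas_cst.
  - by move=> x; rewrite -sqr_cmodE ler_pXn2r ?nnegrE ?cmod_ge0 ?bos_le.
by rewrite -[leLHS](expr1n R 2) ler_pXn2r ?nnegrE.
Qed.

Section Expansion.
Variable J : {fset I}.
Implicit Types v : J -> R[i].

Lemma Linf_lincomb v : Linf (lincomb b v).
Proof.
apply: bmeas_Linf; rewrite /lincomb.
  under eq_fun do rewrite Re_sum; apply: bmeas_sum => j.
  under eq_fun do rewrite ReM; apply: bmeasB; apply: bmeasZ.
    exact: bmeas_Re_bos.
  exact: bmeas_Im_bos.
under eq_fun do rewrite Im_sum; apply: bmeas_sum => j.
under eq_fun do rewrite ImM; apply: bmeasD; apply: bmeasZ.
  exact: bmeas_Im_bos.
exact: bmeas_Re_bos.
Qed.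

Lemma cintegral_lincombJ v k :
  cintegral mu (fun x => lincomb b v x * (b k x)^*) = \sum_(j : J) v j * (val j == k)%:R.
Proof.
have E x : lincomb b v x * (b k x)^* = \sum_(j : J) v j * (b (val j) x * (b k x)^*).
  by rewrite /lincomb mulr_suml; apply: eq_bigr => j _; rewrite mulrA.
have rd (c : bool) : complex.Re (c%:R : R[i]) = c%:R by case: c.
have id (c : bool) : complex.Im (c%:R : R[i]) = 0 by case: c.
apply: complex_inj; rewrite /cintegral /=.
  under eq_Rintegral do rewrite E Re_sum.
  rewrite Re_sum bmeas_Rintegral_sum => [|j]; last first.
    under eq_fun do rewrite ReM; apply: bmeasB; apply: bmeasZ.
      exact: bmeas_Re_bosJ.
    exact: bmeas_Im_bosJ.
  apply: eq_bigr => j _; under eq_Rintegral do rewrite ReM -mulNr.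
  rewrite bmeas_RintegralD; last 2 first.
  - exact/bmeasZ/bmeas_Re_bosJ.
  - exact/bmeasZ/bmeas_Im_bosJ.
  rewrite !bmeas_RintegralZ; last 2 first.
  - exact: bmeas_Im_bosJ.
  - exact: bmeas_Re_bosJ.
  by rewrite Rintegral_Re_bosJ Rintegral_Im_bosJ ReM rd id !mulr0 addr0 subr0.
under eq_Rintegral do rewrite E Im_sum.
rewrite Im_sum bmeas_Rintegral_sum => [|j]; last first.
  under eq_fun do rewrite ImM; apply: bmeasD; apply: bmeasZ.
    exact: bmeas_Im_bosJ.
  exact: bmeas_Re_bosJ.
apply: eq_bigr => j _; under eq_Rintegral do rewrite ImM.
rewrite bmeas_RintegralD; last 2 first.
- exact/bmeasZ/bmeas_Im_bosJ.
- exact/bmeasZ/bmeas_Re_bosJ.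
rewrite !bmeas_RintegralZ; last 2 first.
- exact: bmeas_Re_bosJ.
- exact: bmeas_Im_bosJ.
by rewrite Rintegral_Re_bosJ Rintegral_Im_bosJ ImM rd id !mulr0 add0r.
Qed.

Lemma cintegral_lincombJ_coef v (k : J) :
  cintegral mu (fun x => lincomb b v x * (b (val k) x)^*) = v k.
Proof.
rewrite cintegral_lincombJ (bigD1 k)//= eqxx mulr1 big1 ?addr0// => j jk.
by rewrite (inj_eq val_inj) (negbTE jk) mulr0.
Qed.

Lemma parseval v :
  \int[mu]_x cmod (lincomb b v x) ^+ 2 = \sum_(j : J) cmod (v j) ^+ 2.
Proof.
(* Only one factor of the squared modulus is expanded, so the integrals that remain are given by
   [cintegral_lincombJ_coef]. *)
have E x : cmod (lincomb b v x) ^+ 2 = \sum_(k : J)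
    (complex.Re (v k) * complex.Re (lincomb b v x * (b (val k) x)^*)
     + complex.Im (v k) * complex.Im (lincomb b v x * (b (val k) x)^*)).
  rewrite sqr_cmod; set f := lincomb b v x.
  transitivity (\sum_(k : J) (complex.Re f * complex.Re (v k * b (val k) x)
      + complex.Im f * complex.Im (v k * b (val k) x))).
    by rewrite big_split/= -!mulr_sumr -Re_sum -Im_sum !expr2.
  by apply: eq_bigr => k _; rewrite !ReM !ImM ReJ ImJ; ring.
have Lv := Linf_lincomb v.
have bR (k : J) : bmeas (fun x => complex.Re (lincomb b v x * (b (val k) x)^*)).
  under eq_fun do rewrite ReM ReJ ImJ mulrN opprK.
  by apply: bmeasD; apply: bmeasM; by [exact: Linf_bmeas_Re | exact: bmeas_Re_bos
    | exact: Linf_bmeas_Im | exact: bmeas_Im_bos].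
have bI (k : J) : bmeas (fun x => complex.Im (lincomb b v x * (b (val k) x)^*)).
  under eq_fun do rewrite ImM ReJ ImJ mulrN.
  by apply: bmeasD; [apply: bmeasN|]; apply: bmeasM; by [exact: Linf_bmeas_Re
    | exact: bmeas_Re_bos | exact: Linf_bmeas_Im | exact: bmeas_Im_bos].
under eq_Rintegral do rewrite E.
rewrite bmeas_Rintegral_sum => [|k]; last by apply: bmeasD; exact: bmeasZ.
apply: eq_bigr => k _.
rewrite bmeas_RintegralD; [|exact: bmeasZ..].
rewrite !bmeas_RintegralZ// sqr_cmod !expr2.
have H := cintegral_lincombJ_coef v k.
have /= -> := congr1 (@complex.Re R) H.
by have /= -> := congr1 (@complex.Im R) H.
Qed.

(** Through Parseval, a sup bound confines the coefficients to a bounded set; this is the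
    compactness behind [exists_best_sparse]. *)
Lemma coef_cmod_le v (M : R) (k : J) :
  (forall x, cmod (lincomb b v x) <= M) -> cmod (v k) <= M.
Proof.
move=> vM; have M0 : 0 <= M by apply: le_trans (cmod_ge0 _) (vM point).
rewrite -(@ler_pXn2r _ 2)// ?nnegrE ?cmod_ge0//.
apply: (@le_trans _ _ (\sum_(j : J) cmod (v j) ^+ 2)).
  by rewrite (bigD1 k)//= lerDl sumr_ge0// => j _; exact: sqr_ge0.
rewrite -parseval -[leRHS](Rintegral_prob_cst mu); apply: bmeas_le_Rintegral.
- exact: bmeas_sqr_cmod (Linf_lincomb v).
- exact: bmeas_cst.
- by move=> x; rewrite ler_pXn2r ?nnegrE ?cmod_ge0.
Qed.

End Expansion.

(** An element b_k with k outside J' is orthogonal to the right-hand side, so its coefficient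
    vanishes. This transfers sparsity from an arbitrary index set to coefficients on J. *)
Lemma lincomb_sparse (J J' : {fset I}) (v : J -> R[i]) (c : J' -> R[i]) (k : J) :
  lincomb b v = lincomb b c -> v k != 0 -> val k \in J'.
Proof.
move=> vc; apply: contra_neqT => nk.
rewrite -cintegral_lincombJ_coef vc cintegral_lincombJ big1// => j _.
case: eqP => [jk|_]; last by rewrite mulr0.
by move: nk; rewrite -jk (valP j).
Qed.

End BoundedOrthonormalSystem.

(** * Lower bounds for complex coefficient vectors *)

Section ConeLowerBound.
Context d (T : measurableType d) (R : realType) (mu : probability T R).
Context d' (W : measurableType d') (Pr : probability W R).
Context (m : nat) (t : 'I_m -> {RV Pr >-> T}).
Hypothesis iid_t : iid mu t.
Context (I : choiceType) (b : I -> T -> R[i]) (K : R).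
Hypothesis bos : bounded_orthonormal_system mu b K.
Variables (J : {fset I}) (p A : nat) (Y : R).
Hypotheses (A_ge : 2 ^+ 21 <= A%:R :> R) (p_gt0 : (0 < p)%N).
Hypotheses (J_ge : 1 <= ln (4 * #|` J|).+1%:R :> R) (Y_ge0 : 0 <= Y).
Hypothesis m_ge : 2 ^+ 14 * (A%:R + 2) * K ^+ 2 * 4 ^+ p *
  (p%:R ^+ 2 * ln (4 * #|` J|).+1%:R + Y) <= m%:R.

(** Real and imaginary parts of the b_j serve as a real dictionary; with signs and the zero element
    it has 4 |J| + 1 members. *)
Let part (e : J * bool) x : R :=
  if e.2 then complex.Im (b (val e.1) x) else complex.Re (b (val e.1) x).

Let part_bmeas e : bmeas (part e).
Proof.
by case: e => j [] /=; rewrite /part /=; [exact: bmeas_Im_bos bos _|exact: bmeas_Re_bos bos _].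
Qed.

Let part_le e x : `|part e x| <= K.
Proof.
case: e => j [] /=; rewrite /part /=.
  by apply: le_trans (Im_le_cmod _) _; exact: bos_le bos _ _.
by apply: le_trans (Re_le_cmod _) _; exact: bos_le bos _ _.
Qed.

Let part_l2 e : \int[mu]_x part e x ^+ 2 <= 1.
Proof.
have <- : \int[mu]_x complex.Re (b (val e.1) x * (b (val e.1) x)^*) = 1.
  by rewrite (Rintegral_Re_bosJ bos) eqxx.
apply: bmeas_le_Rintegral; [exact: bmeas_sqr|exact: bmeas_Re_bosJ bos _ _|].
move=> x; rewrite -sqr_cmodE sqr_cmod /part.
by case: e.2; rewrite ?lerDl ?lerDr sqr_ge0.
Qed.

Let card_dict : #|{: option (J * bool * bool)}| = (4 * #|` J|).+1.
Proof.
have e n : (2 * (n * 2))%N = (4 * n)%N by lia.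
by rewrite card_signed_dict card_prod card_bool cardfE; congr _.+1; exact: e.
Qed.

(** The factor 2 in the cone condition covers |Re| + |Im| <= 2 [cmod] for each coefficient. *)
Lemma exists_cone_lower_bound_event : exists G : set W, [/\ measurable G,
  1 - expR (- Y) <= prob Pr G &
  forall w, G w -> forall v : J -> R[i],
    2 * l1norm v <= 2 ^+ p * Num.sqrt (\sum_j cmod (v j) ^+ 2) ->
    (\sum_j cmod (v j) ^+ 2) / 2 ^+ 11 <=
      emp_mean (fun l => t l w) (fun x => cmod (lincomb b v x) ^+ 2)].
Proof.
have [j0 _] : exists j0 : J, True.
  have : (0 < #|` J|)%N.
    rewrite lt0n; apply/eqP => J0; move: J_ge.
    by rewrite J0 muln0 ln1 ler10.
  by rewrite cardfE => /card_gt0P[j0 _]; exists j0.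
have K0 : 0 < K by apply: lt_le_trans (K_ge1 bos (val j0)).
have [|||G [mG PG HG]] := @exists_real_lower_bound_event _ _ _ mu _ _ Pr m t iid_t
  _ K part p A Y K0 part_le part_bmeas part_l2 A_ge p_gt0.
- by rewrite card_dict.
- exact: Y_ge0.
- by rewrite card_dict.
exists G; split => // w /HG{}HG v cone.
set S2 := \sum_j cmod (v j) ^+ 2; pose S := Num.sqrt S2.
have S20 : 0 <= S2 by apply: sumr_ge0 => j _; exact: sqr_ge0.
have SS : S ^+ 2 = S2 by rewrite sqr_sqrtr.
have [S0|S0] := ltP 0 S; last first.
  have -> : S2 = 0.
    have S00 : S = 0 by apply/eqP; rewrite eq_le S0 sqrtr_ge0.
    by rewrite -SS S00 expr0n.
  by rewrite mul0r; apply: emp_mean_ge0 => x; exact: sqr_ge0.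
have Lv := Linf_lincomb bos v.
have bR := bmeas_sqr (Linf_bmeas_Re Lv); have bI := bmeas_sqr (Linf_bmeas_Im Lv).
have total : \int[mu]_x complex.Re (lincomb b v x) ^+ 2
    + \int[mu]_x complex.Im (lincomb b v x) ^+ 2 = S2.
  rewrite -bmeas_RintegralD// /S2 -(parseval bos).
  by apply: eq_Rintegral => x _; rewrite sqr_cmod.
have R0 : 0 <= \int[mu]_x complex.Re (lincomb b v x) ^+ 2.
  by apply: Rintegral_ge0 => x _; exact: sqr_ge0.
have I0 : 0 <= \int[mu]_x complex.Im (lincomb b v x) ^+ 2.
  by apply: Rintegral_ge0 => x _; exact: sqr_ge0.
pose gamR (e : J * bool) := if e.2 then - complex.Im (v e.1) else complex.Re (v e.1).
pose gamI (e : J * bool) := if e.2 then complex.Re (v e.1) else complex.Im (v e.1).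
have ReE x : complex.Re (lincomb b v x) = \sum_e gamR e * part e x.
  rewrite big_prod_bool /lincomb Re_sum; apply: eq_bigr => j _.
  by rewrite ReM /gamR /part /=; ring.
have ImE x : complex.Im (lincomb b v x) = \sum_e gamI e * part e x.
  rewrite big_prod_bool /lincomb Im_sum; apply: eq_bigr => j _.
  by rewrite ImM /gamI /part /=; ring.
have l1R : \sum_e `|gamR e| <= 2 ^+ p * S.
  apply: le_trans cone; rewrite big_prod_bool /l1norm mulr_sumr.
  apply: ler_sum => j _; rewrite /gamR /= normrN.
  by have := Im_le_cmod (v j); have := Re_le_cmod (v j); lra.
have l1I : \sum_e `|gamI e| <= 2 ^+ p * S.
  apply: le_trans cone; rewrite big_prod_bool /l1norm mulr_sumr.
  apply: ler_sum => j _; rewrite /gamI /=.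
  by have := Im_le_cmod (v j); have := Re_le_cmod (v j); lra.
(* By [total] one of the two parts carries at least half of [S2]; the other one is dropped. *)
have [big|small] := leP (S2 / 2) (\int[mu]_x complex.Re (lincomb b v x) ^+ 2).
  apply: (@le_trans _ _ (emp_mean (fun l => t l w) (fun x => complex.Re (lincomb b v x) ^+ 2))).
    have -> : (fun x => complex.Re (lincomb b v x) ^+ 2)
        = fun x => (\sum_e gamR e * part e x) ^+ 2.
      by apply/funext => x; rewrite ReE.
    rewrite -SS; apply: HG => //.
    under eq_Rintegral do rewrite -ReE.
    by rewrite SS big/=; lra.
  by apply: le_emp_mean => x; rewrite sqr_cmod lerDl sqr_ge0.
apply: (@le_trans _ _ (emp_mean (fun l => t l w) (fun x => complex.Im (lincomb b v x) ^+ 2))).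
  have -> : (fun x => complex.Im (lincomb b v x) ^+ 2)
      = fun x => (\sum_e gamI e * part e x) ^+ 2.
    by apply/funext => x; rewrite ImE.
  rewrite -SS; apply: HG => //.
  under eq_Rintegral do rewrite -ImE.
  by rewrite SS; apply/andP; split; lra.
by apply: le_emp_mean => x; rewrite sqr_cmod lerDr sqr_ge0.
Qed.

End ConeLowerBound.

(** * Compactness and basis pursuit *)

Section ClusterPoints.
Variable R : realType.

Lemma invr_nat_le (e : R) : 0 < e -> exists k : nat, k.+1%:R^-1 <= e.
Proof.
move=> e0; exists (Num.trunc e^-1).
rewrite -[leRHS]invrK lef_pV2 ?posrE ?ltr0n ?invr_gt0//.
have e1 : 0 <= e^-1 by rewrite invr_ge0 ltW.
by have /andP[_ /ltW] := truncn_itv e1.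
Qed.

(** Bolzano-Weierstrass from Tychonoff on the box [-M, M]^E, phrased with a cluster point so that no
    subsequence has to be extracted. *)
Lemma exists_cluster_real (E : finType) (u : nat -> E -> R) (M : R) :
  (forall k e, `|u k e| <= M) ->
  exists z : E -> R, forall del, 0 < del -> forall k0,
    exists2 k, (k0 <= k)%N & forall e, `|u k e - z e| < del.
Proof.
move=> uM; pose A (e : E) : set R := `[- M, M]%classic.
pose PT : topologicalType := prod_topology (fun _ : E => R : topologicalType).
have cA : @compact PT [set f | forall e, A e (f e)].
  by apply: (@tychonoff E (fun=> R : topologicalType) A) => e; exact: segment_compact.
pose F : set_system PT := u @ \oo.
have FA : F [set f | forall e, A e (f e)].
  by exists 0%N => // k _ e; rewrite /A /= in_itv/= -ler_norml.
have [z [_ zcl]] := cA F (fmap_proper_filter u _) FA.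
exists z => del del0 k0.
have nB : nbhs (z : PT) [set f : PT | forall e, `|f e - z e| < del].
  apply: (@filter_forall PT E (fun e f => `|f e - z e| < del) (nbhs (z : PT))
    (nbhs_filter (z : PT))) => e.
  have : (fun f : PT => f e : R) f @[f --> (z : PT)] --> (z e : R).
    exact: (@proj_continuous E (fun=> R : topologicalType) e z).
  move=> /cvgrPdist_lt/(_ _ del0); apply: filterS => f /=.
  by rewrite distrC.
have nA : F [set u k | k in [set k | (k0 <= k)%N]].
  by exists k0 => // k k0k; exists k.
have [_ [[k k0k <-] ukz]] := zcl _ _ nA nB.
by exists k.
Qed.

Lemma exists_cluster_complex (E : finType) (u : nat -> E -> R[i]) (M : R) :
  (forall k e, cmod (u k e) <= M) ->
  exists z : E -> R[i], forall del, 0 < del -> forall k0,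
    exists2 k, (k0 <= k)%N & forall e, cmod (u k e - z e) < del.
Proof.
move=> uM.
pose r k (e : E * bool) : R := if e.2 then complex.Im (u k e.1) else complex.Re (u k e.1).
have rM k e : `|r k e| <= M.
  rewrite /r; case: e => e [] /=.
    exact: le_trans (Im_le_cmod _) (uM k e).
  exact: le_trans (Re_le_cmod _) (uM k e).
have [z Hz] := exists_cluster_real rM.
exists (fun e => z (e, false) +i* z (e, true)) => del del0 k0.
have [|k k0k Hk] := Hz (del / 2) _ k0; first by rewrite divr_gt0.
exists k => // e; apply: le_lt_trans (cmod_le_normD _) _.
have := Hk (e, false); have := Hk (e, true); rewrite /r /=.
by case: (u k e) => a c /=; lra.
Qed.

End ClusterPoints.

(** * Attained sparse approximations *)

Section SparseApproximation.
Context d (T : measurableType d) (R : realType) (mu : probability T R).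
Context (I : choiceType) (b : I -> T -> R[i]) (K : R).
Hypothesis bos : bounded_orthonormal_system mu b K.
Variable J : {fset I}.
Implicit Types v z : J -> R[i].

Definition sparsity v : nat := #|[set j | v j != 0]%SET|.

Lemma lincombB v z x : lincomb b v x - lincomb b z x = lincomb b (fun j => v j - z j) x.
Proof. by rewrite /lincomb -sumrB; apply: eq_bigr => j _; rewrite mulrBl. Qed.

Lemma cmod_lincomb_le v (del : R) x : (forall j, cmod (v j) <= del) ->
  cmod (lincomb b v x) <= #|` J|%:R * K * del.
Proof.
move=> vdel; apply: le_trans (cmod_sum _ _ _) _.
have e1 : #|` J|%:R * K * del = \sum_(j : J) del * K.
  by rewrite sumr_const cardfE -mulr_natl; ring.
rewrite e1; apply: ler_sum => j _.
by rewrite cmodM ler_pM ?cmod_ge0 ?(bos_le bos).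
Qed.

(** A vector closer to z than the smallest nonzero modulus of z cannot vanish on the support of z.
    The default 1 of the minimum serves the case z = 0. *)
Lemma sparsity_cluster_le (u : nat -> J -> R[i]) z (s : nat) :
  (forall k, (sparsity (u k) <= s)%N) ->
  (forall del, 0 < del -> exists k, forall j, cmod (u k j - z j) < del) ->
  (sparsity z <= s)%N.
Proof.
move=> us ucl; pose del := \big[Num.min/1]_(j | z j != 0) cmod (z j).
have del0 : 0 < del.
  apply: lt_bigmin => // j zj; rewrite lt_neqAle cmod_ge0 andbT.
  by apply: contra_neq zj => /esym; exact: cmod_eq0.
have [k Hk] := ucl _ del0; apply: leq_trans (us k); apply: subset_leq_card.
apply/fintype.subsetP => j; rewrite !inE => zj; apply: contraTneq (Hk j) => ->.
by rewrite -leNgt sub0r cmodN bigmin_le_cond.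
Qed.

(** The program is run with [eta] itself, so approximants within eta + e need not be feasible and a
    limit has to be taken. Sparsity survives it by lower semicontinuity. *)
Lemma exists_best_sparse (f : T -> R[i]) (s : nat) (eta : R) : Linf f ->
  (forall e, 0 < e -> exists v, (sparsity v <= s)%N /\
     forall x, cmod (f x - lincomb b v x) <= eta + e) ->
  exists z, (sparsity z <= s)%N /\ forall x, cmod (f x - lincomb b z x) <= eta.
Proof.
move=> Lf H; have [M fM] := Linf_bounded Lf.
have H' k : exists v, (sparsity v <= s)%N /\
    forall x, cmod (f x - lincomb b v x) <= eta + k.+1%:R^-1.
  by apply: H; rewrite invr_gt0.
have [u Hu] := choice H'.
have ubnd k j : cmod (u k j) <= M + (eta + 1).
  apply: (coef_cmod_le bos) => x.
  have -> : lincomb b (u k) x = f x - (f x - lincomb b (u k) x) by rewrite subKr.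
  apply: le_trans (cmodB _ _) (lerD (fM x) _).
  have [_ /(_ x) h] := Hu k; apply: (le_trans h).
  by rewrite lerD2l invf_le1 ?ler1n.
have [z Hz] := exists_cluster_complex ubnd; exists z; split.
  apply: (sparsity_cluster_le (u := u)) => [k|del del0]; first by have [] := Hu k.
  by have [k _ Hk] := Hz _ del0 0%N; exists k.
move=> x; apply/ler_addgt0Pr => e e0.
pose C := `|#|` J|%:R * K| + 1.
have C0 : 0 < C by rewrite ltr_wpDl.
have e2 : 0 < e / (2 * C) by rewrite divr_gt0// mulr_gt0.
have [k0 k0e] := invr_nat_le (e := e / 2) ltac:(lra).
have [k k0k Hk] := Hz _ e2 k0.
have -> : f x - lincomb b z x
    = (f x - lincomb b (u k) x) + lincomb b (fun j => u k j - z j) x.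
  by rewrite -lincombB addrA subrK.
apply: le_trans (cmodD _ _) _; have [_ /(_ x) fu] := Hu k.
have zu := @cmod_lincomb_le (fun j => u k j - z j) _ x (fun j => ltW (Hk j)).
have Ce : #|` J|%:R * K * (e / (2 * C)) <= e / 2.
  apply: (@le_trans _ _ (C * (e / (2 * C)))).
    rewrite ler_wpM2r ?(ltW e2)//; apply: le_trans (ler_norm _) _.
    by rewrite lerDl.
  by rewrite le_eqVlt; apply/orP; left; apply/eqP; field; rewrite gt_eqF.
have ke : k.+1%:R^-1 <= k0.+1%:R^-1 :> R by rewrite lef_pV2 ?posrE ?ltr0n// ler_nat ltnS.
apply: le_trans (lerD fu zu) _; move: ke Ce k0e.
by move: k.+1%:R^-1 k0.+1%:R^-1 => x1 x2; lra.
Qed.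

End SparseApproximation.

Lemma sqr_cmodB_le (R : rcfType) (z w : R[i]) :
  cmod (z - w) ^+ 2 <= 2 * cmod z ^+ 2 + 2 * cmod w ^+ 2.
Proof.
case: z w => [a b] [c e]; rewrite !sqr_cmod /=.
by have := sqr_ge0 (a + c); have := sqr_ge0 (b + e); lra.
Qed.

(** * Existence of minimizers and the cone condition *)

Section BasisPursuitSolution.
Context d (T : measurableType d) (R : realType) (I : choiceType) (b : I -> T -> R[i]).
Context (J : {fset I}) (m : nat).
Implicit Types (eta : R) (ts : 'I_m -> T) (y : 'I_m -> R[i]) (z v : J -> R[i]).

Lemma bpdn_feasibleP eta ts y z : 0 <= eta ->
  bpdn_feasible b eta ts y z <->
  \sum_(l < m) cmod (lincomb b z (ts l) - y l) ^+ 2 <= eta ^+ 2 * m%:R.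
Proof.
move=> eta0; have s0 : 0 <= \sum_(l < m) cmod (lincomb b z (ts l) - y l) ^+ 2.
  by apply: sumr_ge0 => l _; exact: sqr_ge0.
rewrite /bpdn_feasible /l2vnorm.
have -> : eta * Num.sqrt m%:R = Num.sqrt (eta ^+ 2 * m%:R).
  by rewrite sqrtrM ?sqr_ge0// sqrtr_sqr ger0_norm.
by rewrite ler_sqrt// mulr_ge0// sqr_ge0.
Qed.

Lemma bpdn_feasible_sample (f : T -> R[i]) eta ts z : 0 <= eta ->
  (forall x, cmod (f x - lincomb b z x) <= eta) ->
  bpdn_feasible b eta ts (fun l => f (ts l)) z.
Proof.
move=> eta0 fz; apply/bpdn_feasibleP => //.
have -> : eta ^+ 2 * m%:R = \sum_(l < m) eta ^+ 2.
  by rewrite sumr_const card_ord -[RHS]mulr_natr.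
apply: ler_sum => l _; rewrite -opprB cmodN.
by rewrite ler_pXn2r ?nnegrE ?cmod_ge0.
Qed.

Lemma l1norm_ge0 z : 0 <= l1norm z.
Proof. by apply: sumr_ge0 => j _; exact: cmod_ge0. Qed.

Lemma cmod_le_l1norm z j : cmod (z j) <= l1norm z.
Proof.
by rewrite /l1norm (bigD1 j)//= lerDl sumr_ge0// => i _; exact: cmod_ge0.
Qed.

Lemma lincomb_lipschitz ts : exists C : R, 0 <= C /\
  forall z v del, (forall j, cmod (z j - v j) <= del) ->
    forall l, cmod (lincomb b z (ts l) - lincomb b v (ts l)) <= C * del.
Proof.
exists (\sum_(l < m) \sum_(j : J) cmod (b (val j) (ts l))); split.
  by apply: sumr_ge0 => l _; apply: sumr_ge0 => j _; exact: cmod_ge0.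
move=> z v del zv l; rewrite /lincomb -sumrB.
apply: le_trans (cmod_sum _ _ _) _.
(* For empty J the hypothesis on [del] is void and [del] may be negative; both sides are then 0. *)
have [J0|[j0 _]] := set_0Vmem [set: J]%SET.
  rewrite big1 => [|j]; last by have := finset.in_setT j; rewrite J0 finset.inE.
  rewrite big1 ?mul0r// => i _; rewrite big1// => j.
  by have := finset.in_setT j; rewrite J0 finset.inE.
have del0 : 0 <= del by apply: le_trans (cmod_ge0 _) (zv j0).
apply: (@le_trans _ _ ((\sum_(j : J) cmod (b (val j) (ts l))) * del)).
  rewrite mulr_suml; apply: ler_sum => j _; rewrite -mulrBl cmodM mulrC.
  by rewrite ler_wpM2l ?cmod_ge0.
rewrite ler_wpM2r// [leRHS](bigD1 l)//= lerDl sumr_ge0// => i _.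
by apply: sumr_ge0 => j _; exact: cmod_ge0.
Qed.

(** [bpdn_selection] yields a minimizer only when one exists, and 0 otherwise. A minimizing sequence
    has bounded l1 norm, hence a cluster point; the constraint is closed and the l1 norm
    continuous. *)
Lemma exists_bpdn_solution eta ts y : 0 <= eta ->
  (exists z, bpdn_feasible b eta ts y z) -> exists z, bpdn_solution b eta ts y z.
Proof.
move=> eta0 [z0 fz0].
pose S : set R := [set l1norm z | z in [set z : J -> R[i] | bpdn_feasible b eta ts y z]].
have hS : has_inf S.
  split; first by exists (l1norm z0), z0.
  by exists 0 => _ [z _ <-]; exact: l1norm_ge0.
have H k : exists z, bpdn_feasible b eta ts y z /\ l1norm z <= inf S + k.+1%:R^-1.
  have k1 : 0 < k.+1%:R^-1 :> R by rewrite invr_gt0.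
  have [_ [z fz <-] zlt] := inf_adherent k1 hS.
  by exists z; split => //; exact: ltW.
have [u Hu] := choice H.
have ubnd k j : cmod (u k j) <= inf S + 1.
  apply: le_trans (cmod_le_l1norm _ j) _; have [_ h] := Hu k; apply: (le_trans h).
  by rewrite lerD2l invf_le1 ?ler1n.
have [z Hz] := exists_cluster_complex ubnd; exists z; split.
  apply/bpdn_feasibleP => //; apply/ler_addgt0Pr => e e0.
  have [C [C0 HC]] := lincomb_lipschitz ts.
  set M := eta ^+ 2 * m%:R; have M0 : 0 <= M by rewrite mulr_ge0 ?sqr_ge0.
  (* From (a + C del)^2 <= a^2 + B del for 0 <= a <= sqrt M and 0 <= del <= 1. *)
  pose B := 2 * (Num.sqrt M * C) + C ^+ 2.
  have B0 : 0 <= B by rewrite addr_ge0 ?sqr_ge0// !mulr_ge0// sqrtr_ge0.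
  pose del := Num.min 1 (e / (m%:R * B + 1)).
  have mB : 0 < m%:R * B + 1 by rewrite ltr_wpDl// mulr_ge0.
  have del0 : 0 < del by rewrite lt_min ltr01/= divr_gt0.
  have del1 : del <= 1 by rewrite ge_min lexx.
  have dele : (m%:R * B + 1) * del <= e.
    by rewrite mulrC -ler_pdivlMr// ge_min lexx orbT.
  have [k _ Hk] := Hz _ del0 0%N.
  have [/(bpdn_feasibleP _ _ _ eta0) fu _] := Hu k.
  have term l : cmod (lincomb b z (ts l) - y l) ^+ 2
      <= cmod (lincomb b (u k) (ts l) - y l) ^+ 2 + B * del.
    have a2 : cmod (lincomb b (u k) (ts l) - y l) <= Num.sqrt M.
      rewrite -(@ler_pXn2r _ 2)// ?nnegrE ?cmod_ge0 ?sqrtr_ge0// sqr_sqrtr//.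
      apply: le_trans fu; rewrite (bigD1 l)//= lerDl sumr_ge0// => i _.
      exact: sqr_ge0.
    have c2 : cmod (lincomb b z (ts l) - lincomb b (u k) (ts l)) <= C * del.
      by apply: HC => j; rewrite -cmodN opprB ltW.
    have tri : cmod (lincomb b z (ts l) - y l)
        <= cmod (lincomb b (u k) (ts l) - y l) + C * del.
      have -> : lincomb b z (ts l) - y l = (lincomb b (u k) (ts l) - y l)
          + (lincomb b z (ts l) - lincomb b (u k) (ts l)) by ring.
      by apply: le_trans (cmodD _ _) _; rewrite lerD2l.
    have a0 := cmod_ge0 (lincomb b (u k) (ts l) - y l).
    have z0' := cmod_ge0 (lincomb b z (ts l) - y l).
    apply: (@le_trans _ _ ((cmod (lincomb b (u k) (ts l) - y l) + C * del) ^+ 2)).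
      by rewrite ler_pXn2r ?nnegrE// addr_ge0// mulr_ge0// ltW.
    have Cd : 0 <= C * del by rewrite mulr_ge0// ltW.
    have h1 := ler_wpM2r Cd a2.
    have h2 : (C * del) ^+ 2 <= C ^+ 2 * del.
      by rewrite exprMn ler_wpM2l ?sqr_ge0// expr2 ler_piMr// ltW.
    by rewrite /B; lra.
  apply: (@le_trans _ _ (\sum_(l < m) (cmod (lincomb b (u k) (ts l) - y l) ^+ 2 + B * del))).
    by apply: ler_sum => l _; exact: term.
  rewrite big_split/= sumr_const card_ord -mulr_natl; apply: lerD => //.
  by apply: le_trans dele; rewrite mulrA ler_wpM2r ?ltW// ltrDl.
move=> z' fz'; apply: (@le_trans _ _ (inf S)); last first.
  by apply: ge_inf; [exact: hS.2|exists z'].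
apply/ler_addgt0Pr => e e0.
have N0 : 0 < #|` J|%:R + 1 :> R by rewrite ltr_wpDl.
have e2 : 0 < e / (2 * (#|` J|%:R + 1)) by rewrite divr_gt0// mulr_gt0.
have [k0 k0e] := invr_nat_le (e := e / 2) ltac:(lra).
have [k k0k Hk] := Hz _ e2 k0; have [_ uk] := Hu k.
have ke : k.+1%:R^-1 <= k0.+1%:R^-1 :> R by rewrite lef_pV2 ?posrE ?ltr0n// ler_nat ltnS.
have zu : l1norm z <= l1norm (u k) + #|` J|%:R * (e / (2 * (#|` J|%:R + 1))).
  have -> : #|` J|%:R * (e / (2 * (#|` J|%:R + 1)))
      = \sum_(j : J) e / (2 * (#|` J|%:R + 1)) by rewrite sumr_const cardfE mulr_natl.
  rewrite /l1norm -big_split/=; apply: ler_sum => j _.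
  have -> : z j = u k j - (u k j - z j) by ring.
  by apply: le_trans (cmodB _ _) _; rewrite lerD2l ltW.
have Ne : #|` J|%:R * (e / (2 * (#|` J|%:R + 1))) <= e / 2.
  apply: (@le_trans _ _ ((#|` J|%:R + 1) * (e / (2 * (#|` J|%:R + 1))))).
    by rewrite ler_wpM2r ?(ltW e2)// lerDl.
  by rewrite le_eqVlt; apply/orP; left; apply/eqP; field; rewrite gt_eqF.
apply: (le_trans zu); move: uk ke Ne k0e.
move: k.+1%:R^-1 k0.+1%:R^-1 (_ * (e / _)) => x1 x2 x3; lra.
Qed.

Lemma sum_sqr_le_card (E : finType) (S : {set E}) (a : E -> R) :
  (\sum_(j in S) a j) ^+ 2 <= #|S|%:R * \sum_(j in S) a j ^+ 2.
Proof.
rewrite expr2 mulr_suml.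
under eq_bigr do rewrite mulr_sumr.
apply: (@le_trans _ _ (\sum_(i in S) \sum_(j in S) (a i ^+ 2 / 2 + a j ^+ 2 / 2))).
  apply: ler_sum => i _; apply: ler_sum => j _.
  by have := sqr_ge0 (a i - a j); lra.
under eq_bigr do rewrite big_split/= sumr_const -mulr_suml -[X in X + _]mulr_natl.
rewrite big_split/= sumr_const -mulr_sumr -mulr_suml -[X in _ + X]mulr_natl.
by rewrite le_eqVlt; apply/orP; left; apply/eqP; field.
Qed.

(** Off the support of z, x and v agree; on it |x| >= |z| - |v|. Hence the l1 mass of v off the
    support is at most its mass on the support, where Cauchy-Schwarz applies to at most s
    entries. *)
Lemma l1norm_cone_le z x (s : nat) : (sparsity z <= s)%N -> l1norm x <= l1norm z ->
  l1norm (fun j => x j - z j)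
    <= 2 * Num.sqrt (s%:R * \sum_j cmod (x j - z j) ^+ 2).
Proof.
move=> zs xz; set v := fun j => x j - z j.
pose S := [set j | z j != 0]%SET.
have split_sum (F : J -> R) : \sum_j F j = \sum_(j in S) F j + \sum_(j in ~: S) F j.
  rewrite (bigID (mem S))/=; congr (_ + _).
  by apply: eq_bigl => j; rewrite finset.in_setC.
have zS : \sum_(j in ~: S) cmod (z j) = 0.
  rewrite big1// => j; rewrite !finset.inE negbK => /eqP ->; exact: cmod0.
have xS : \sum_(j in S) cmod (z j) - \sum_(j in S) cmod (v j) <= \sum_(j in S) cmod (x j).
  rewrite -sumrB; apply: ler_sum => j _.
  have -> : z j = x j - v j by rewrite /v; ring.
  by have := cmodB (x j) (v j); lra.
have xSc : \sum_(j in ~: S) cmod (x j) = \sum_(j in ~: S) cmod (v j).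
  by apply: eq_bigr => j; rewrite !finset.inE negbK /v => /eqP ->; rewrite subr0.
move: xz; rewrite /l1norm !split_sum zS xSc => xz.
apply: (@le_trans _ _ (2 * \sum_(j in S) cmod (v j))); first by lra.
rewrite ler_wpM2l//.
have S0 : 0 <= \sum_(j in S) cmod (v j) by apply: sumr_ge0 => j _; exact: cmod_ge0.
rewrite -[leLHS]ger0_norm// -sqrtr_sqr ler_wsqrtr//.
apply: le_trans (sum_sqr_le_card _ _) _; apply: ler_pM => //.
- by apply: sumr_ge0 => j _; exact: sqr_ge0.
- by rewrite ler_nat.
- by rewrite lerDl; apply: sumr_ge0 => j _; exact: sqr_ge0.
Qed.

End BasisPursuitSolution.

(** * Recovery from the lower bound on the cone *)

Section Recovery.
Context d (T : measurableType d) (R : realType) (mu : probability T R).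
Context (I : choiceType) (b : I -> T -> R[i]) (K : R).
Hypothesis bos : bounded_orthonormal_system mu b K.
Context (J : {fset I}) (m : nat).
Implicit Types (f g : T -> R[i]) (v z : J -> R[i]).

Lemma l2norm_le g (c : R) : Linf g -> 0 <= c ->
  \int[mu]_x cmod (g x) ^+ 2 <= c ^+ 2 -> (l2norm mu g <= c%:E)%E.
Proof.
move=> Lg c0 gc; rewrite /l2norm unlock /=.
have bg := bmeas_sqr_cmod Lg.
have -> : (\int[mu]_x (`|(cmod (g x))%:E| `^ 2) = (\int[mu]_x cmod (g x) ^+ 2)%:E)%E.
  rewrite /Rintegral fineK; last exact/integrable_fin_num/bmeas_integrable.
  apply: eq_integral => x _.
  by rewrite abse_EFin ger0_norm ?cmod_ge0// poweR_EFin powR_mulrn ?cmod_ge0.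
rewrite poweR_EFin lee_fin powR12_sqrt; last first.
  by apply: Rintegral_ge0 => x _; exact: sqr_ge0.
by rewrite -[leRHS]ger0_norm// -sqrtr_sqr ler_wsqrtr.
Qed.

(* The cone condition on x - z comes from l1-minimality of x, the bound on
   its empirical norm from feasibility of both x and z. *)
Lemma bpdn_l2norm_le f (x : J -> R[i]) z (ts : 'I_m -> T) (eta : R) (s p : nat) :
  (0 < m)%N -> 0 <= eta -> Linf f -> (sparsity z <= s)%N -> 16 * s%:R <= 4 ^+ p :> R ->
  (forall t, cmod (f t - lincomb b z t) <= eta) ->
  bpdn_solution b eta ts (fun l => f (ts l)) x ->
  (forall v, 2 * l1norm v <= 2 ^+ p * Num.sqrt (\sum_j cmod (v j) ^+ 2) ->
    (\sum_j cmod (v j) ^+ 2) / 2 ^+ 11 <=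
      emp_mean ts (fun t => cmod (lincomb b v t) ^+ 2)) ->
  (l2norm mu (fun t => f t - lincomb b x t)%R <= (2 ^+ 8 * eta)%:E)%E.
Proof.
move=> m0 eta0 Lf zs sp fz [fx xmin] cone.
have mR0 : 0 < m%:R :> R by rewrite ltr0n.
have zfeas := bpdn_feasible_sample ts eta0 fz.
pose v j := x j - z j; set S := \sum_j cmod (v j) ^+ 2.
have S0 : 0 <= S by apply: sumr_ge0 => j _; exact: sqr_ge0.
(* Twice the bound of [l1norm_cone_le] is 4 sqrt (s S), the origin of the 16 in 16 s <= 4^p. *)
have vcone : 2 * l1norm v <= 2 ^+ p * Num.sqrt S.
  have h := l1norm_cone_le zs (xmin z zfeas).
  apply: (@le_trans _ _ (2 * (2 * Num.sqrt (s%:R * S)))); first by rewrite ler_wpM2l.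
  have -> : 2 ^+ p * Num.sqrt S = Num.sqrt (4 ^+ p * S).
    by rewrite sqrtrM ?exprn_ge0// expr4n -expr2 sqrtr_sqr ger0_norm// exprn_ge0.
  have -> : 2 * (2 * Num.sqrt (s%:R * S)) = Num.sqrt (4 ^+ 2 * (s%:R * S)).
    by rewrite [RHS](sqrtrM _ (sqr_ge0 4)) sqrtr_sqr ger0_norm// mulrA -natrM.
  rewrite ler_wsqrtr// mulrA ler_wpM2r// (_ : 4 ^+ 2 = 16)//; ring.
have [empx empz] := (fx, zfeas).
move/(bpdn_feasibleP _ _ _ _ eta0) in empx; move/(bpdn_feasibleP _ _ _ _ eta0) in empz.
have emp_v : emp_mean ts (fun t => cmod (lincomb b v t) ^+ 2) <= 4 * eta ^+ 2.
  rewrite /emp_mean ler_pdivrMr//.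
  apply: (@le_trans _ _ (\sum_(l < m) (2 * cmod (lincomb b x (ts l) - f (ts l)) ^+ 2
      + 2 * cmod (lincomb b z (ts l) - f (ts l)) ^+ 2))).
    apply: ler_sum => l _; rewrite -lincombB.
    have -> : lincomb b x (ts l) - lincomb b z (ts l)
        = (lincomb b x (ts l) - f (ts l)) - (lincomb b z (ts l) - f (ts l)) by ring.
    exact: sqr_cmodB_le.
  by rewrite big_split/= -!mulr_sumr; lra.
have Sle : S <= 2 ^+ 13 * eta ^+ 2.
  have := le_trans (cone v vcone) emp_v; rewrite ler_pdivrMr ?exprn_gt0//.
  by rewrite -/S => h; apply: (le_trans h); rewrite le_eqVlt; apply/orP; left; apply/eqP; ring.
have Lx := Linf_lincomb bos x.
have Ld : Linf (fun t => f t - lincomb b x t).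
  apply: bmeas_Linf.
    rewrite (_ : (fun _ => _) = fun t => complex.Re (f t) - complex.Re (lincomb b x t)).
      by apply: bmeasB; exact: Linf_bmeas_Re.
    by apply/funext => t; case: (f t) => ? ?; case: (lincomb b x t).
  rewrite (_ : (fun _ => _) = fun t => complex.Im (f t) - complex.Im (lincomb b x t)).
    by apply: bmeasB; exact: Linf_bmeas_Im.
  by apply/funext => t; case: (f t) => ? ?; case: (lincomb b x t).
apply: l2norm_le => //; first by rewrite mulr_ge0// exprn_ge0.
have Lv := Linf_lincomb bos v.
apply: (@le_trans _ _ (\int[mu]_t (2 * eta ^+ 2 + 2 * cmod (lincomb b v t) ^+ 2))).
  apply: bmeas_le_Rintegral; first exact: bmeas_sqr_cmod.
    by apply: bmeasD; [exact: bmeas_cst|apply/bmeasZ/bmeas_sqr_cmod].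
  move=> t; rewrite -lincombB.
  have -> : f t - lincomb b x t = (f t - lincomb b z t)
      - (lincomb b x t - lincomb b z t) by ring.
  apply: le_trans (sqr_cmodB_le _ _) _; rewrite lerD2r ler_wpM2l//.
  by rewrite ler_pXn2r ?nnegrE ?cmod_ge0.
rewrite bmeas_RintegralD; [|exact: bmeas_cst|exact/bmeasZ/bmeas_sqr_cmod].
rewrite Rintegral_prob_cst bmeas_RintegralZ; last exact: bmeas_sqr_cmod.
rewrite (parseval bos) -/S exprMn -exprM.
apply: (@le_trans _ _ (2 * eta ^+ 2 + 2 * (2 ^+ 13 * eta ^+ 2))); first by lra.
have := sqr_ge0 eta; lra.
Qed.

End Recovery.

(** * Quasi-projections *)

Section QuasiProjection.
Context d (T : measurableType d) (R : realType) (mu : probability T R).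
Context (I : choiceType) (b : I -> T -> R[i]) (K : R).
Hypothesis bos : bounded_orthonormal_system mu b K.
Implicit Types f g r : T -> R[i].

Lemma Linf_linear (a : R[i]) f g : Linf f -> Linf g -> Linf (fun x => a * f x + g x).
Proof.
move=> Lf Lg; apply: bmeas_Linf.
  under eq_fun do rewrite ReD ReM.
  apply: bmeasD; last exact: Linf_bmeas_Re.
  by apply: bmeasB; apply: bmeasZ; [exact: Linf_bmeas_Re|exact: Linf_bmeas_Im].
under eq_fun do rewrite ImD ImM.
apply: bmeasD; last exact: Linf_bmeas_Im.
by apply: bmeasD; apply: bmeasZ; [exact: Linf_bmeas_Im|exact: Linf_bmeas_Re].
Qed.

Lemma Linf0 : Linf (fun _ : T => 0 : R[i]).
Proof. by apply: bmeas_Linf; exact: bmeas_cst. Qed.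

Variables (kappa n : nat) (J Jstar : {fset I}) (tau : R).
Variable P : (T -> R[i]) -> T -> R[i].
Hypothesis quasi : quasi_projection b kappa n J Jstar tau P.

(** [opnorm] only tests the unit ball, so r is divided by a positive majorant [M]; its norm itself
    might be 0. *)
Lemma quasi_projection_le r (M : R) : Linf r -> 0 < M ->
  (forall x, cmod (r x) <= M) -> forall x, cmod (P r x) <= tau * M.
Proof.
have [_ [_ Plin] _ _ Pop] := quasi => Lr M0 rM x.
have P0 : P (fun=> 0) = (fun=> 0).
  have := Plin 1 _ _ Linf0 Linf0.
  rewrite (_ : (fun x => 1 * 0 + 0) = (fun=> 0 : R[i])).
    move=> H; apply/funext => y; have := congr1 (@^~ y) H.
    by rewrite mul1r => /eqP; rewrite -subr_eq0 opprD addrA subrr sub0r oppr_eq0 => /eqP.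
  by apply/funext => y; rewrite mulr0 addr0.
pose a : R[i] := (M^-1)%:C.
have aE : cmod a = M^-1.
  by rewrite /a /= expr0n addr0 sqrtr_sqr ger0_norm// invr_ge0 ltW.
have Pa : P (fun x => a * r x + 0) = (fun x => a * P r x).
  by rewrite (Plin a _ _ Lr Linf0) P0; apply/funext => y; rewrite addr0.
have La : Linf (fun x => a * r x + 0) by apply: Linf_linear => //; exact: Linf0.
have : (linfnorm (P (fun x => a * r x + 0)%R) <= tau%:E)%E.
  apply: le_trans Pop; apply: ereal_sup_ubound; exists (fun y => a * r y + 0)%R => //.
  split => //; apply/linfnorm_leP => y; rewrite addr0 cmodM aE.
  by rewrite mulrC ler_pdivrMr// mul1r.
move=> /linfnorm_leP/(_ x); rewrite Pa cmodM aE.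
by rewrite mulrC ler_pdivrMr.
Qed.

Lemma sparsity_le_of_Sigma (v : Jstar -> R[i]) (s : nat) :
  Sigma b s (lincomb b v) -> (sparsity v <= s)%N.
Proof.
move=> [J' [c [cJ' vc]]]; apply: leq_trans cJ'.
rewrite /sparsity cardE -(size_map val); apply: uniq_leq_size.
  by rewrite map_inj_uniq ?enum_uniq//; exact: val_inj.
move=> i /mapP[k]; rewrite mem_enum finset.inE => vk ->.
exact: (lincomb_sparse bos vc vk).
Qed.

Lemma worst_case_error_ge0 (S F : set (T -> R[i])) qn f : unit_ball F qn f ->
  (0 <= worst_case_error F qn S)%E.
Proof.
move=> Ff; apply: le_ereal_sup_tmp; exists (ereal_inf [set linfnorm (fun x => f x - g x) | g in S]).
  by exists f.
by apply: le_ereal_inf_tmp => _ [g _ <-]; exact: linfnorm_ge0.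
Qed.

Lemma worst_case_error_lt (S F : set (T -> R[i])) qn f (s del : R) :
  unit_ball F qn f -> 0 < del -> worst_case_error F qn S = s%:E ->
  exists2 g, S g & forall x, cmod (f x - g x) <= s + del.
Proof.
move=> Ff del0 sE.
have : (ereal_inf [set linfnorm (fun x => f x - g x)%R | g in S] < (s + del)%:E)%E.
  apply: (@le_lt_trans _ _ s%:E); last by rewrite lte_fin ltrDl.
  by rewrite -sE; apply: ereal_sup_ubound; exists f.
move=> /ereal_inf_lt[_ [g Sg <-] /ltW gs]; exists g => //.
exact/linfnorm_leP.
Qed.

(** As P h = h, f - P g = (f - h) - P (f - h) + P (f - g) for near-best g in [Sigma b n] and h in
    [V b J]; the three terms match the three parts of [eta]. *)
Lemma quasi_projection_sparse_approx (F : set (T -> R[i])) qn (eta : R) f :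
  F `<=` @Linf _ T R ->
  eta%:E = (tau%:E * sigma_ b n F qn + (1 + tau)%:E * E_ b J F qn)%E ->
  unit_ball F qn f ->
  0 <= eta /\ forall e, 0 < e -> exists v : Jstar -> R[i],
    (sparsity v <= kappa * n)%N /\ forall x, cmod (f x - lincomb b v x) <= eta + e.
Proof.
move=> FL etaE Ff; have [tau0 [PL Plin] [PS PV] PJ _] := quasi.
have s0 := worst_case_error_ge0 (Sigma b n) Ff.
have e0 := worst_case_error_ge0 (V b J) Ff.
(* As tau > 0 and both errors are nonnegative, the finite value [eta] excludes that one of them is
   infinite. *)
have [s sE] : exists s, sigma_ b n F qn = s%:E.
  move: etaE s0; rewrite /E_ /sigma_; case: worst_case_error => [s _ _|/= H|//].
    by exists s.
  move: H; rewrite gt0_muley ?lte_fin// addye// gt_eqF//.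
  by apply: (@lt_le_trans _ _ 0%E); rewrite ?ltNy0// mule_ge0// lee_fin addr_ge0// ltW.
have [e eE] : exists e, E_ b J F qn = e%:E.
  move: etaE e0; rewrite sE /E_; case: worst_case_error => [e _ _|/= H|//].
    by exists e.
  by move: H; rewrite gt0_muley// lte_fin addr_gt0.
move: s0 e0; rewrite -/(sigma_ b n F qn) -/(E_ b J F qn) sE eE !lee_fin => s0 e0.
have {}etaE : eta = tau * s + (1 + tau) * e.
  by move: etaE; rewrite sE eE -!EFinM -EFinD => -[].
split; first by rewrite etaE addr_ge0// mulr_ge0// ?addr_ge0// ltW.
(* The slack [del] enters once through f - h and tau times through each of the two images under
   P. *)
move=> eps eps0; pose del := eps / (1 + 2 * tau).
have t1 : 0 < 1 + 2 * tau by rewrite addr_gt0// mulr_gt0.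
have del0 : 0 < del by rewrite divr_gt0.
have [g Sg gs] := worst_case_error_lt Ff del0 sE.
have [h Vh he] := worst_case_error_lt Ff del0 eE.
have Lf : Linf f by apply: FL; case: Ff.
have Lg : Linf g by have [J' [c [_ ->]]] := Sg; exact: (Linf_lincomb bos c).
have Lh : Linf h by have [c ->] := Vh; exact: (Linf_lincomb bos c).
have [v vE] := PJ g Lg.
exists v; split; first by apply: sparsity_le_of_Sigma; rewrite -vE; exact: PS.
move=> x; rewrite -vE.
have P1 := Plin (-1) g f Lg Lf; have P2 := Plin (-1) h f Lh Lf.
have M1 : cmod (P (fun x => -1 * g x + f x) x) <= tau * (s + del).
  apply: quasi_projection_le; [exact: Linf_linear|by rewrite ltr_wpDl|].
  by move=> y; rewrite mulN1r addrC.
have M2 : cmod (P (fun x => -1 * h x + f x) x) <= tau * (e + del).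
  apply: quasi_projection_le; [exact: Linf_linear|by rewrite ltr_wpDl|].
  by move=> y; rewrite mulN1r addrC.
have -> : f x - P g x = (f x - h x) - P (fun x => -1 * h x + f x) x
    + P (fun x => -1 * g x + f x) x.
  by rewrite P1 P2 (PV h Vh); ring.
apply: le_trans (cmodD _ _) _; apply: le_trans (lerD (cmodB _ _) M1) _.
apply: le_trans (lerD (lerD (he x) M2) (lexx _)) _.
have -> : eps = (1 + 2 * tau) * del by rewrite mulrC divfK// gt_eqF.
by rewrite etaE le_eqVlt; apply/orP; left; apply/eqP; ring.
Qed.

End QuasiProjection.

(** * The main theorem *)

Section SampleComplexity.
Variable R : realType.

Lemma ln2_ge_half : 1 / 2 <= ln 2 :> R.
Proof.
rewrite -ler_expR lnK ?posrE//.
have h : 1 / 2 <= expR (- (1 / 2)) :> R by have := expR_ge1Dx (- (1 / 2) : R); lra.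
rewrite -[leLHS]invrK -expRN invf_ple ?posrE ?expR_gt0//; lra.
Qed.

Lemma lnS_ge_half (k : nat) : (0 < k)%N -> 1 / 2 <= ln k.+1%:R :> R.
Proof.
move=> k0; apply: le_trans ln2_ge_half _.
by rewrite ler_ln ?posrE ?ltr0n// ler_nat.
Qed.

Lemma exists_pow4 (s : nat) : (0 < s)%N -> exists p : nat,
  [/\ (0 < p)%N, 16 * s%:R <= 4 ^+ p :> R & 4 ^+ p.-1 <= 16 * s%:R :> R].
Proof.
move=> s0; have ex : exists p, (16 * s <= 4 ^ p)%N.
  by exists (16 * s)%N; exact/ltnW/ltn_expl.
case: (ex_minnP ex) => p sp pmin; exists p.
have p0 : (0 < p)%N.
  by rewrite lt0n; apply/eqP => p0; move: sp; rewrite p0 expn0; lia.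
split => //; first by rewrite -natrX -natrM ler_nat.
rewrite -natrX -natrM ler_nat leqNgt; apply/negP => H.
by have := pmin p.-1 (ltnW H); rewrite leqNgt ltn_predL p0.
Qed.

(** As the logarithms a and c are at least 1/2, sums of them are bounded by products: p <= 20 a c,
    so p^2 is absorbed by a^3 c^3, and so is c^3. The constant is 2^33 = 2^14 * 2^6 * 2^13, where
    2^6 comes from 4^p <= 64 kappa n. *)
Lemma sample_size_suffices (A : nat) (K : R) (kappa n N p : nat) (x : R) :
  (0 < kappa)%N -> (0 < n)%N -> (0 < N)%N -> (0 < p)%N ->
  4 ^+ p.-1 <= 16 * (kappa * n)%:R :> R ->
  2 ^+ 33 * (A%:R + 2) * K ^+ 2 * kappa%:R * ln kappa.+1%:R ^+ 3
              * n%:R * ln n.+1%:R ^+ 3 * ln N.+1%:R <= x ->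
  2 ^+ 14 * (A%:R + 2) * K ^+ 2 * 4 ^+ p *
    (p%:R ^+ 2 * ln (4 * N).+1%:R + ln n.+1%:R ^+ 3 * ln N%:R) <= x.
Proof.
move=> ka0 n0 N0 p0 p4; apply: le_trans.
have a2 := lnS_ge_half ka0; have c2 := lnS_ge_half n0.
set a := ln kappa.+1%:R in a2 *; set c := ln n.+1%:R in c2 *.
have l2 := lnS_ge_half N0; set l := ln N.+1%:R in l2 *.
have ka1 : 0 < kappa%:R :> R by rewrite ltr0n.
have n1 : 0 < n%:R :> R by rewrite ltr0n.
have p1 : 1 <= p%:R :> R by rewrite ler1n.
have l4 : ln (4 * N).+1%:R <= 3 * l.
  rewrite mulr_natl -lnXn ?ltr0n// ler_ln ?posrE ?exprn_gt0 ?ltr0n//.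
  by rewrite -natrX ler_nat; nia.
have lN : ln N%:R <= l by rewrite ler_ln ?posrE ?ltr0n// ler_nat.
have lN0 : 0 <= ln N%:R :> R by rewrite ln_ge0// ler1n.
have pac : p%:R <= 20 * (a * c).
  have : ln (4 ^+ p.-1) <= ln (2 ^+ 4 * kappa.+1%:R * n.+1%:R :> R).
    rewrite ler_ln ?posrE ?mulr_gt0 ?exprn_gt0 ?ltr0n//.
    apply: (le_trans p4); rewrite natrM mulrA (_ : 16 = 2 ^+ 4); last by ring.
    by apply: ler_pM; rewrite ?mulr_ge0 ?exprn_ge0 ?ler_nat// ler_wpM2l ?exprn_ge0// ler_nat.
  have lnX (z : R) k : 0 < z -> ln (z ^+ k) = k%:R * ln z.
    by move=> z0; rewrite lnXn// mulr_natl.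
  rewrite !lnM ?posrE ?mulr_gt0 ?exprn_gt0 ?ltr0n// !lnX// -/a -/c.
  have -> : ln 4 = 2 * ln 2 :> R.
    by rewrite -lnX//; congr ln; ring.
  have la : ln 2 <= a by rewrite ler_ln ?posrE ?ltr0n// ler_nat.
  have pp : p.-1%:R = p%:R - 1 :> R by rewrite -subn1 natrB.
  have := ln2_ge_half; rewrite pp; nra.
have ac0 : 0 <= a * c by rewrite mulr_ge0//; lra.
have ac4 : 1 / 4 <= a * c by nra.
set g := a ^+ 3 * c ^+ 3.
have g0 : 0 <= g by rewrite mulr_ge0// exprn_ge0//; lra.
have acg : (a * c) ^+ 2 <= 4 * g.
  rewrite /g -exprMn exprS [(a * c) ^+ 3]exprS expr1.
  have := sqr_ge0 (a * c); nra.
have p2 : p%:R ^+ 2 <= 2 ^+ 11 * g.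
  apply: (@le_trans _ _ ((20 * (a * c)) ^+ 2)).
    by apply: lerXn2r; rewrite ?nnegrE//; exact: mulr_ge0.
  rewrite exprMn; lra.
have cg : c ^+ 3 <= 8 * g.
  have a3 : (1 / 2) ^+ 3 <= a ^+ 3 by rewrite ler_pXn2r ?nnegrE//; lra.
  have c30 : 0 <= c ^+ 3 by rewrite exprn_ge0//; lra.
  have := ler_wpM2r c30 a3; rewrite /g; lra.
have l0 : 0 <= l by lra.
have sum_le : p%:R ^+ 2 * ln (4 * N).+1%:R + c ^+ 3 * ln N%:R <= 2 ^+ 13 * (g * l).
  apply: (@le_trans _ _ (2 ^+ 11 * g * (3 * l) + 8 * g * l)).
    apply: lerD; apply: ler_pM => //; rewrite ?sqr_ge0 ?exprn_ge0//; last by lra.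
    by rewrite ln_ge0// ler1n.
  have := mulr_ge0 g0 l0; lra.
have p64 : 4 ^+ p <= 2 ^+ 6 * (kappa%:R * n%:R) :> R.
  rewrite -(prednK p0) exprS; apply: (@le_trans _ _ (4 * (16 * (kappa * n)%:R))).
    by rewrite ler_wpM2l.
  by rewrite natrM le_eqVlt; apply/orP; left; apply/eqP; ring.
have B0 : 0 <= 2 ^+ 14 * (A%:R + 2) * K ^+ 2 :> R.
  apply: mulr_ge0 (sqr_ge0 _); apply: mulr_ge0; first exact: exprn_ge0.
  exact: addr_ge0.
have s0 : 0 <= p%:R ^+ 2 * ln (4 * N).+1%:R + c ^+ 3 * ln N%:R.
  rewrite addr_ge0// mulr_ge0 ?sqr_ge0 ?exprn_ge0//; last by lra.
  by rewrite ln_ge0// ler1n.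
apply: (@le_trans _ _ (2 ^+ 14 * (A%:R + 2) * K ^+ 2 *
    ((2 ^+ 6 * (kappa%:R * n%:R)) * (2 ^+ 13 * (g * l))))).
  rewrite -[leLHS]mulrA; apply: ler_wpM2l => //.
  by apply: ler_pM => //; rewrite exprn_ge0.
by rewrite /g le_eqVlt; apply/orP; left; apply/eqP; ring.
Qed.

End SampleComplexity.

Theorem theorem2p14 (R : realType) :
  exists C Ct gamma : R, [/\ 0 < C, 0 < Ct, 0 < gamma &
  forall (d : measure_display) (Omega : measurableType d)
    (mu : probability Omega R)
    (I : choiceType) (b : I -> Omega -> R[i]) (K : R)
    (F : set (Omega -> R[i])) (qn : (Omega -> R[i]) -> R)
    (kappa n : nat) (J Jstar : {fset I})
    (P : (Omega -> R[i]) -> (Omega -> R[i])) (tau eta : R) (m : nat),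
  bounded_orthonormal_system mu b K ->
  quasi_normed_space F qn ->
  compactly_embedded F qn ->
  Jstar != fset0 ->
  quasi_projection b kappa n J Jstar tau P ->
  opnorm P = tau%:E ->
  eta%:E = (tau%:E * sigma_ b n F qn + (1 + tau)%:E * E_ b J F qn)%E ->
  let N := #|` Jstar| in
  Num.ceil (C * K ^+ 2 * kappa%:R * ln kappa.+1%:R ^+ 3
              * n%:R * ln n.+1%:R ^+ 3 * ln N.+1%:R) <= m%:Z ->
  forall (d' : measure_display) (W : measurableType d')
    (Pr : probability W R) (t : 'I_m -> {RV Pr >-> Omega})
    (xsharp : ('I_m -> Omega) -> ('I_m -> R[i]) -> (Jstar -> R[i])),
  iid mu t ->
  bpdn_selection b eta xsharp ->
  let Reta (w : W) (f : Omega -> R[i]) :=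
    reconstruct b xsharp (fun l => t l w) (fun l => f (t l w)) in
  (exists A : set W,
     [/\ measurable A,
         ((1 - N%:R `^ (- (gamma * ln n.+1%:R ^+ 3)))%:E <= Pr A)%E &
         forall w, A w ->
           (ereal_sup [set l2norm mu (fun x => f x - Reta w f x)%R
                      | f in unit_ball F qn] <= (Ct * eta)%:E)%E]) /\
  (forall w f, F f -> V b Jstar (Reta w f))].
Proof.
have [A A_ge] : exists A : nat, 2 ^+ 21 <= A%:R :> R.
  have h : 0 <= 2 ^+ 21 :> R by exact: exprn_ge0.
  by exists (Num.trunc (2 ^+ 21 : R)).+1; have /andP[_ /ltW] := truncn_itv h.
have A0 : 0 < A%:R + 2 :> R by rewrite ltr_wpDl.
(* The last witness is 1 because exp (- Y) with Y = ln (n + 1)^3 ln N is the required power of N;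
   2^8 is the constant of [bpdn_l2norm_le]. *)
exists (2 ^+ 33 * (A%:R + 2)), (2 ^+ 8), 1; split.
- by rewrite mulr_gt0// exprn_gt0.
- by rewrite exprn_gt0.
- exact: ltr01.
move=> d Omega mu I b K F qn kappa n J Jstar P tau eta m bos _ [FL _] Jstar0 quasi _.
move=> etaE N m_ge d' W Pr t xsharp iid_t sel Reta.
split; last by move=> w f _; exists (xsharp (fun l => t l w) (fun l => f (t l w))).
have N0 : (0 < N)%N by rewrite cardfs_gt0.
have solution w f : 0 <= eta -> (exists z, bpdn_feasible b eta (fun l => t l w)
    (fun l => f (t l w)) (z : Jstar -> R[i])) ->
    bpdn_solution b eta (fun l => t l w) (fun l => f (t l w))
      (xsharp (fun l => t l w) (fun l => f (t l w))).
  by move=> eta0 ez; have [+ _] := sel (fun l => t l w) (fun l => f (t l w));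
    apply; exact: exists_bpdn_solution.
have sparse f : unit_ball F qn f -> [/\ 0 <= eta, Linf f & exists z : Jstar -> R[i],
    (sparsity z <= kappa * n)%N /\ forall x, cmod (f x - lincomb b z x) <= eta].
  move=> Ff; have Lf : Linf f by apply: FL; case: Ff.
  have [eta0 happrox] := quasi_projection_sparse_approx bos quasi FL etaE Ff.
  by split => //; exact: (exists_best_sparse bos Lf happrox).
(* If n = 0 or N = 1, the claimed probability is 0 and the empty event suffices. *)
have [trivial|nontrivial] := boolP ((n == 0)%N || (N == 1)%N).
  exists set0; split => //.
  rewrite measure0 lee_fin subr_le0; case/orP: trivial => /eqP ->.
    by rewrite ln1 expr0n mulr0 oppr0 powRr0.
  by rewrite powR1.
move: nontrivial; rewrite negb_or -lt0n => /andP[n0 N1].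
have N2 : (2 <= N)%N by case: N N0 N1 {m_ge} => [|[]].
(* For kappa = 0 the sample may be empty, but z has no nonzero entry, and l1-minimality forces x = z
   for every sample. *)
have [kappa0|kappa0] := posnP kappa.
  exists setT; split => //.
    by rewrite probability_setT lee_fin gerBl powR_ge0.
  move=> w _; apply: ge_ereal_sup => _ [f Ff <-].
  have [eta0 Lf [z [zs fz]]] := sparse f Ff.
  have [xfeas xmin] := solution w f eta0 (ex_intro _ z (bpdn_feasible_sample _ eta0 fz)).
  set x := xsharp _ _ in xfeas xmin.
  have xz j : x j = z j.
    have := l1norm_cone_le zs (xmin z (bpdn_feasible_sample _ eta0 fz)).
    rewrite kappa0 mul0n mul0r sqrtr0 mulr0 => le0.
    apply/eqP; rewrite -subr_eq0; apply/eqP/cmod_eq0/eqP.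
    rewrite eq_le cmod_ge0 andbT.
    exact: le_trans (cmod_le_l1norm (fun j => x j - z j) j) le0.
  have -> : Reta w f = lincomb b z.
    by rewrite /Reta /reconstruct; congr lincomb; apply/funext.
  have Ld : Linf (fun y => f y - lincomb b z y).
    have := Linf_linear (-1) (Linf_lincomb bos z) Lf.
    by congr Linf; apply/funext => y; rewrite mulN1r addrC.
  apply: l2norm_le => //; first by rewrite mulr_ge0// exprn_ge0.
  rewrite -[leRHS](Rintegral_prob_cst mu); apply: bmeas_le_Rintegral.
  - exact: bmeas_sqr_cmod.
  - exact: bmeas_cst.
  - move=> y; apply: lerXn2r; rewrite ?nnegrE ?cmod_ge0 ?mulr_ge0 ?exprn_ge0//.
    by apply: le_trans (fz y) _; rewrite ler_peMl// exprn_ege1// ler1n.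
have s0 : (0 < kappa * n)%N by rewrite muln_gt0 kappa0 n0.
have [p [p0 p16 p4]] := exists_pow4 R s0.
pose Y := ln n.+1%:R ^+ 3 * ln N%:R : R.
have Y0 : 0 <= Y.
  by rewrite mulr_ge0 ?exprn_ge0// ln_ge0// ler1n.
have J_ge : 1 <= ln (4 * #|` Jstar|).+1%:R :> R.
  apply: (@le_trans _ _ (ln (2 ^+ 3))).
    by rewrite lnXn// -[leRHS]mulr_natl; have := ln2_ge_half R; lra.
  by rewrite ler_ln ?posrE ?exprn_gt0 ?ltr0n// -natrX ler_nat -/N; lia.
have size_ge := sample_size_suffices (A := A) (K := K) (x := m%:R)
  kappa0 n0 N0 p0 p4.
have m_ge' : 2 ^+ 33 * (A%:R + 2) * K ^+ 2 * kappa%:R * ln kappa.+1%:R ^+ 3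
    * n%:R * ln n.+1%:R ^+ 3 * ln N.+1%:R <= m%:R :> R.
  by move: m_ge; rewrite ceil_le_int.
have {}size_ge := size_ge m_ge'.
have m0 : (0 < m)%N.
  rewrite -(ltr0n R); apply: lt_le_trans size_ge.
  have [j0 _] : exists j : Jstar, True.
    by move: N0; rewrite /N cardfE => /card_gt0P[j0 _]; exists j0.
  have K0 : 0 < K by apply: lt_le_trans (K_ge1 bos (val j0)).
  rewrite !mulr_gt0 ?exprn_gt0// ltr_wpDr// mulr_gt0 ?exprn_gt0 ?ltr0n//.
  exact: lt_le_trans J_ge.
have [G [mG PG HG]] := exists_cone_lower_bound_event iid_t bos A_ge p0 J_ge Y0 size_ge.
exists G; split => //.
  have -> : Pr G = (prob Pr G)%:E by rewrite fineK// fin_num_measure.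
  rewrite lee_fin; apply: le_trans PG; rewrite lerD2l lerN2.
  rewrite /powR pnatr_eq0 gtn_eqF// ler_expR mul1r /Y mulNr.
  exact: lexx.
move=> w Gw; apply: ge_ereal_sup => _ [f Ff <-].
have [eta0 Lf [z [zs fz]]] := sparse f Ff.
apply: (bpdn_l2norm_le bos m0 eta0 Lf zs p16 fz _ (HG w Gw)).
exact: solution w f eta0 (ex_intro _ z (bpdn_feasible_sample _ eta0 fz)).
Qed.
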